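(* For a complex number $k$, let $m(k)$ denote the logarithmic Mahler measure of the two-variable Laurent polynomial $P_k(x,y)=x+\frac{1}{x}+y+\frac{1}{y}+k$, that is, $$m(k)=\int_0^1\int_0^1 \log\left|P_k\left(e^{2\pi i t_1},e^{2\pi i t_2}\right)\right|\,dt_1\,dt_2 .$$ Then $$m(8)=4\,m(2)$$ and $$m(5)=6\,m(1).$$
   Context: The (logarithmic) Mahler measure of a non-zero Laurent polynomial $P(x_1,\dots,x_n)$ with complex coefficients is $$m(P)=\int_0^1\cdots\int_0^1\log\left|P\left(e^{2\pi i t_1},\dots,e^{2\pi i t_n}\right)\right|\,dt_1\cdots dt_n ,$$ and $m(k)$ is shorthand for $m(P_k)$. *)

(* Defs.v *)
From mathcomp Require Import all_boot all_order all_algebra.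
From mathcomp Require Import complex.
From mathcomp Require Import all_classical all_reals all_analysis.
Import Order.TTheory GRing.Theory Num.Theory.

Set Implicit Arguments.
Unset Strict Implicit.
Unset Printing Implicit Defensive.

Local Open Scope ring_scope.

(* [e^(2 pi i t)], written out since the libraries have no complex
   exponential. *)
Definition expi2pi (R : realType) (t : R) : R[i] :=
  (cos (2 * pi * t) +i* sin (2 * pi * t))%C.

(* A two-variable Laurent polynomial enters through its evaluation map.
   [Normc.normc] is the complex modulus as an element of [R], and [lne] maps
   [0] to [-oo].  The integrand is unbounded below when [P] has zeros on the
   torus, which rules out Riemann integrals and calls for Lebesgue ones; being
   valued in [\bar R], they need no default value when infinite. *)
Definition mahler_measure (R : realType) (P : R[i] -> R[i] -> R[i]) : \bar R :=
  (\int[lebesgue_measure]_(t2 in `[0%R, 1%R]%classic)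
     \int[lebesgue_measure]_(t1 in `[0%R, 1%R]%classic)
       lne (Normc.normc (P (expi2pi t1) (expi2pi t2)))%:E)%E.

Definition laurentP (R : realType) (k x y : R[i]) : R[i] :=
  x + x^-1 + y + y^-1 + k.

Definition mahler_m (R : realType) (k : R[i]) : \bar R :=
  mahler_measure (laurentP k).

(* Main.v *)
(** Writing 2 cos a + 2 cos b = 4 cos ((a + b) / 2) cos ((a - b) / 2), Fubini
    and Jensen's formula turn m(k), for k > 0, into
      (2 / pi) int_0^(pi/2) j_k (4 sin t) dt,
    where j_k(A) = log ((k + sqrt (k^2 - A^2)) / 2) if |A| <= k and
    j_k(A) = log (|A| / 2) otherwise.  Put Lam(x) = int_0^x log (2 sin t) dt.
    As Lam(pi/2) = 0, for k <= 4 this integral is the one up to arcsin (k/4)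
    minus Lam(arcsin (k/4)).  Each identity then expresses that a combination
    of two such primitives and of values of Lam at integer combinations of two
    angles is constant along a curve, because the coefficients of both
    differentials vanish there.  The combinations come from exotic relations
    {f, 1 - f} in K_2 of elliptic curves of conductors 24 and 15, namely
    f = (Y - X) / 4 on Y^2 = X (X + 1) (X + 4) and f = (Y - X)^2 / (16 X) on
    Y^2 = X (X^2 - 7 X + 16): the Bloch-Wigner dilogarithm of f is a sum of
    Lobachevsky functions of the angles of the triangle 0, 1, f. *)

From HB Require Import structures.
Require Import Defs.
From mathcomp Require Import all_boot all_order all_algebra.
From mathcomp Require Import complex.
From mathcomp Require Import all_classical all_reals all_analysis.
From mathcomp Require Import measurable_realfun ring lra.
Import Order.TTheory GRing.Theory Num.Theory.
Import numFieldNormedType.Exports.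

Set Implicit Arguments.
Unset Strict Implicit.
Unset Printing Implicit Defensive.

Local Open Scope classical_set_scope.
Local Open Scope ring_scope.

(** * Periodic functions *)

(** Writing A = k sin(theta) with 0 < theta <= pi/2 gives j_k(A) - log (A / 2) = log cot (theta /
    2). So each primitive of j_k is paired with a copy of Lam: along a curve on which the half-angle
    tangents are rational functions of the other sines and cosines, the coefficients of the
    differentials are logarithms of monomials, and their vanishing is a multiplicative identity
    between sines. No dilogarithm is ever evaluated. Each curve starts where the angles of both
    primitives are 0. It ends where the angle for the larger k is pi/2 and the angle for the smaller
    k is arcsin (k/4); there the remaining values of Lam cancel in pairs. The analytic obstacle is
    that for k <= 4 the polynomial has zeros on the torus, so the logarithm is unbounded below.
    Logarithms are therefore extended-real functions with value -oo at 0, the mean of log |2 sin| is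
    reached by monotone convergence, and the integrals are exchanged only after subtracting the
    integrand from an upper bound. *)

Section translation.
Context {R : realType}.
Notation mu := (@lebesgue_measure R).
Local Open Scope ereal_scope.

Definition translation (c x : measurableTypeR R) : measurableTypeR R := (x + c)%R.

Lemma measurable_translation (c : R) : measurable_fun [set: R] (translation c).
Proof. exact: (@measurable_funD _ _ R _ id (cst c)). Qed.

HB.instance Definition _ (c : R) :=
  isMeasurableFun.Build _ _ _ _ (translation c) (measurable_translation c).

Lemma lebesgue_measure_translation (c : R) (A : set R) : measurable A ->
  pushforward mu (translation c) A = mu A.
Proof.
move=> mA; apply/esym/lebesgue_measure_unique => //= _ [[a b]] _ <-.
rewrite /pushforward /=.
have -> : translation c @^-1` `]a, b]%classic = `](a - c)%R, (b - c)%R]%classic.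
  by apply/seteqP; split => x /=; rewrite !in_itv/= /translation ltrBlDr lerBrDr.
rewrite !lebesgue_measure_itv/= !lte_fin ltrD2r; case: ifPn => // _.
by rewrite -!EFinB; congr EFin; ring.
Qed.

Lemma ge0_integral_translation (f : R -> \bar R) (a b c : R) :
  measurable_fun [set: R] f -> (forall x, 0 <= f x) ->
  \int[mu]_(x in `[a, b]) f (x + c)%R =
  \int[mu]_(x in `[(a + c)%R, (b + c)%R]) f x.
Proof.
move=> mf f0.
have -> : `[a, b]%classic = translation c @^-1` `[(a + c)%R, (b + c)%R].
  by apply/seteqP; split => x /=; rewrite !in_itv/= !lerD2r.
transitivity (\int[pushforward mu (translation c)]_(x in `[(a + c)%R, (b + c)%R]) f x).
  rewrite (@ge0_integral_pushforward _ _ (measurableTypeR R) (measurableTypeR R)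
    R _ (measurable_translation c))//.
  exact: (@measurable_funS _ _ _ _ [set: R]).
by apply: eq_measure_integral => //= A mA AS; exact: lebesgue_measure_translation.
Qed.

Lemma ge0_integral_itv_cat (f : R -> \bar R) (a b c : R) : (a <= b <= c)%R ->
  measurable_fun [set: R] f -> (forall x, 0 <= f x) ->
  \int[mu]_(x in `[a, c]) f x =
  \int[mu]_(x in `[a, b]) f x + \int[mu]_(x in `[b, c]) f x.
Proof.
move=> /andP[ab bc] mf f0.
rewrite -(integral_itv_bndo_bndc (a := BLeft a) (r := b)); last exact: measurable_funS mf.
rewrite (@itv_bndbnd_setU _ _ _ (BLeft b))//.
rewrite ge0_integral_setU//; first exact: measurable_funS mf.
apply/disj_setPLR => x /=; rewrite !in_itv/= => /andP[_ xb].
by rewrite leNgt xb.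
Qed.

(** Only the fractional part [d] of [c] matters. The interval [d, 1 + d] is then cut at 1, and its
    second piece is moved back by one period onto [0, d]. *)
Lemma ge0_integral_periodic (f : R -> \bar R) (c : R) :
  measurable_fun [set: R] f -> (forall x, 0 <= f x) ->
  (forall x, f (x + 1)%R = f x) ->
  \int[mu]_(x in `[0%R, 1%R]) f (x + c)%R = \int[mu]_(x in `[0%R, 1%R]) f x.
Proof.
move=> mf f0 f1.
have fn (n : nat) x : f (x + n%:R)%R = f x.
  by elim: n => [|n IH]; rewrite ?addr0// -addn1 natrD addrA f1.
have fz (n : int) x : f (x + n%:~R)%R = f x.
  case: n => n; first exact: fn.
  by rewrite NegzE mulrNz -[LHS](fn n.+1) subrK.
have [d [d0 d1 fd]] : exists d, [/\ 0 <= d, d <= 1 & forall x, f (x + c) = f (x + d)]%R.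
  exists (c - (Num.floor c)%:~R)%R; split.
  - by rewrite subr_ge0 ge_floor.
  - by rewrite lerBlDl -(intrD1 (Num.floor c)) ltW// floorD1_gt.
  - by move=> x; rewrite -[RHS](fz (Num.floor c)) addrA subrK.
under eq_integral do rewrite fd.
rewrite ge0_integral_translation// add0r.
rewrite (@ge0_integral_itv_cat _ _ 1) ?d1 ?lerDl//.
rewrite [RHS](@ge0_integral_itv_cat _ _ d) ?d0 ?d1// addeC; congr (_ + _).
rewrite -[X in `[X, _]](add0r 1%R) [X in `[_, X]](addrC 1%R) -ge0_integral_translation//.
by apply: eq_integral => x _; rewrite f1.
Qed.

End translation.

Section periodic.
Context {R : realType}.
Notation mu := (@lebesgue_measure R).
Local Open Scope ereal_scope.

(** Shifting the positive and negative parts separately lets the lemma serve before integrability is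
    known: applied to absolute values, it is what transfers integrability to shifted functions. *)
Lemma integral_periodic (f : R -> \bar R) (c : R) :
  measurable_fun [set: R] f -> (forall x, f (x + 1)%R = f x) ->
  \int[mu]_(x in `[0%R, 1%R]) f (x + c)%R = \int[mu]_(x in `[0%R, 1%R]) f x.
Proof.
move=> mf f1; rewrite [LHS]integralE [RHS]integralE; congr (_ - _).
  rewrite -[RHS](ge0_integral_periodic c).
  - by apply: eq_integral => x _; rewrite !funeposE.
  - exact: measurable_funepos.
  - by [].
  - by move=> x; rewrite !funeposE f1.
rewrite -[RHS](ge0_integral_periodic c).
- by apply: eq_integral => x _; rewrite !funenegE.
- exact: measurable_funeneg.
- by [].
- by move=> x; rewrite !funenegE f1.
Qed.

(** The integral over [0, 2] is computed twice: by the substitution u = 2 x, and as two copies of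
    one period. *)
Lemma integral_periodic_double (f : R -> R) :
  continuous f -> (forall x, f (x + 1)%R = f x) ->
  \int[mu]_(x in `[0%R, 1%R]) (f (2 * x)%R)%:E =
  \int[mu]_(x in `[0%R, 1%R]) (f x)%:E.
Proof.
move=> cf f1.
have mf : measurable_fun [set: R] (EFin \o f).
  by apply/measurable_EFinP; exact: continuous_measurable_fun.
have itg (g : R -> R) a b : continuous g -> mu.-integrable `[a, b] (EFin \o g).
  move=> cg; apply: continuous_compact_integrable; first exact: segment_compact.
  by apply: continuous_subspaceT.
have c2 : continuous (fun x : R => 2 * x)%R.
  by move=> x; apply: cvgM; [exact: cvg_cst|exact: cvg_id].
have cf2 : continuous (f \o (fun x : R => 2 * x)%R).
  by move=> x; apply: (@continuous_comp _ _ _ (fun x : R => 2 * x)%R f); [exact: c2|exact: cf].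
have d2 (x : R) : is_derive x 1%R (fun x : R => 2 * x)%R 2%R.
  by apply: is_derive_eq; rewrite /GRing.scale/= ?(mulr1,mulr0,add0r,addr0).
have D2 : derive1 (fun x : R => 2 * x)%R = cst 2%R.
  by apply/funext => x; rewrite derive1E; exact: derive_val.
have h : \int[mu]_(x in `[0%R, 2%R]) (f x)%:E =
    2%:E * \int[mu]_(x in `[0%R, 1%R]) (f (2 * x)%R)%:E.
  have := @integration_by_substitution_increasing R (fun x => 2 * x)%R f 0%R 1%R ler01.
  rewrite mulr0 mulr1 D2 => ->.
  - rewrite -integralZl//; last exact: itg.
    by apply: eq_integral => x _; rewrite /= mulrC.
  - by move=> x y _ _ xy; rewrite ltr_pM2l.
  - by move=> x _; exact: cvg_cst.
  - exact: is_cvg_cst.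
  - exact: is_cvg_cst.
  - split.
    + by move=> x _; exact: ex_derive.
    + by apply: cvg_at_right_filter; exact: c2.
    + by apply: cvg_at_left_filter; exact: c2.
  - exact: continuous_subspaceT.
have h' : \int[mu]_(x in `[0%R, 2%R]) (f x)%:E =
    2%:E * \int[mu]_(x in `[0%R, 1%R]) (f x)%:E.
  have e (g : R -> \bar R) : measurable_fun [set: R] g -> (forall x, 0 <= g x) ->
      (forall x, g (x + 1)%R = g x) ->
      \int[mu]_(x in `[0%R, 2%R]) g x = 2%:E * \int[mu]_(x in `[0%R, 1%R]) g x.
    move=> mg g0 g1; rewrite (@ge0_integral_itv_cat _ _ _ 1) ?ler01 ?ler1n//.
    have -> : \int[mu]_(x in `[1%R, 2%R]) g x = \int[mu]_(x in `[0%R, 1%R]) g x.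
      have := ge0_integral_translation 0%R 1%R 1%R mg g0.
      rewrite add0r -[(1 + 1)%R]/2%R => <-.
      by apply: eq_integral => x _; rewrite g1.
    by rewrite -[2%R]/(1 + 1)%R EFinD ge0_muleDl ?lee_fin// !mul1e.
  rewrite [LHS]integralE [X in _ * X]integralE.
  rewrite (e (EFin \o f)^\+)//; last 2 first.
  - exact: measurable_funepos.
  - by move=> x; rewrite !funeposE/= f1.
  rewrite (e (EFin \o f)^\-)//; last 2 first.
  - exact: measurable_funeneg.
  - by move=> x; rewrite !funenegE/= f1.
  have fN : \int[mu]_(x in `[0%R, 1%R]) (EFin \o f)^\- x \is a fin_num.
    by rewrite integrable_neg_fin_num//; exact: itg.
  have mB (u v : \bar R) : v \is a fin_num -> 2%:E * (u - v) = 2%:E * u - 2%:E * v.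
    by move=> vf; rewrite muleBr// fin_num_adde_defl// fin_numN.
  exact/esym/(mB _ _ fN).
move: h; rewrite h' => /(congr1 (fun x => (2^-1)%:E * x)).
by rewrite !muleA -!EFinM mulVf// !mul1e => ->.
Qed.

End periodic.

(** * Jensen's formula *)

Section circle_mean.
Context {R : realType}.
Notation mu := (@lebesgue_measure R).

Lemma continuous_itv_integrable (f : R -> R) (a b : R) : continuous f ->
  mu.-integrable `[a, b] (EFin \o f).
Proof.
move=> cf; apply: continuous_compact_integrable; first exact: segment_compact.
by apply: continuous_subspaceT.
Qed.

Lemma cos2piD1 (t : R) : cos (2 * pi * (t + 1)) = cos (2 * pi * t).
Proof. by rewrite mulrDr mulr1 mulr_natl cosD2pi. Qed.

Lemma continuous_cos2pi : continuous (fun t : R => cos (2 * pi * t)).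
Proof.
move=> x; apply: continuous_comp; last exact: continuous_cos.
by apply: cvgM; [exact: cvg_cst|exact: cvg_id].
Qed.

Lemma continuous_ln_comp (f : R -> R) (x : R) : 0 < f x -> {for x, continuous f} ->
  {for x, continuous (fun x => ln (f x))}.
Proof. by move=> f0 cf; apply: continuous_comp => //; exact: continuous_ln. Qed.

(** This is |1 - r z|^2 at z = e^(2 pi i t). *)
Let q (r t : R) := 1 - 2 * r * cos (2 * pi * t) + r ^+ 2.

Let q_lb r t : (1 - `|r|) ^+ 2 <= q r t.
Proof.
have := ler_norm (r * cos (2 * pi * t)); rewrite normrM => h.
have h2 : `|r| * `|cos (2 * pi * t)| <= `|r| by rewrite ler_piMr ?cos_max.
rewrite /q sqrrB expr1n mul1r -normrX (ger0_norm (sqr_ge0 r)) -[2 * r * _]mulrA -mulr_natr; lra.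
Qed.

Let q_gt0 r t : `|r| < 1 -> 0 < q r t.
Proof. by move=> r1; rewrite (lt_le_trans _ (q_lb r t))// exprn_gt0// subr_gt0. Qed.

Let q_ub r t : `|r| < 1 -> q r t <= 4.
Proof.
move=> r1; have := ler_norm (- (r * cos (2 * pi * t))); rewrite normrN normrM => h.
have h2 : `|r| * `|cos (2 * pi * t)| <= `|r| by rewrite ler_piMr ?cos_max.
have h3 : r ^+ 2 <= 1.
  by rewrite -[r ^+ 2]ger0_norm ?sqr_ge0// normrX expr_le1// ltW.
rewrite /q -[2 * r * _]mulrA; lra.
Qed.

Let continuous_lnq r : `|r| < 1 -> continuous (fun t => ln (q r t)).
Proof.
move=> r1 x; apply: continuous_ln_comp; first exact: q_gt0.
apply: cvgD; last exact: cvg_cst.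
apply: cvgB; first exact: cvg_cst.
by apply: cvgM; [exact: cvg_cst|exact: continuous_cos2pi].
Qed.

Let P r := \int[mu]_(t in `[0, 1]) ln (q r t).

(** A shift of [t] by half a period changes the sign of the cosine. *)
Let PN r : P (- r) = P r.
Proof.
rewrite /P /Rintegral; congr fine; rewrite -[RHS](integral_periodic 2^-1).
- apply: eq_integral => t _; congr (ln _)%:E; rewrite /q.
  have -> : 2 * pi * (t + 2^-1) = 2 * pi * t + pi by field.
  by rewrite cosDpi; ring.
- apply/measurable_EFinP/measurableT_comp; first exact: measurable_ln.
  apply: continuous_measurable_fun => x.
  apply: cvgD; last exact: cvg_cst.
  apply: cvgB; first exact: cvg_cst.
  by apply: cvgM; [exact: cvg_cst|exact: continuous_cos2pi].
- by move=> t; rewrite /q cos2piD1.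
Qed.

(* |1 - r z| |1 + r z| = |1 - r^2 z^2| for |z| = 1. *)
Let P_double r : `|r| < 1 -> P r + P r = P (r ^+ 2).
Proof.
move=> r1; have r21 : `|r ^+ 2| < 1 by rewrite normrX exprn_ilt1.
have rN1 : `|- r| < 1 by rewrite normrN.
rewrite -{2}PN -RintegralD//; try exact: continuous_itv_integrable (continuous_lnq _).
rewrite /P /Rintegral; congr fine.
rewrite -[RHS](integral_periodic_double (continuous_lnq r21)); last first.
  by move=> t; rewrite /q cos2piD1.
apply: eq_integral => t _; congr EFin.
rewrite -lnM ?posrE ?q_gt0//; congr ln; rewrite /q.
have -> : 2 * pi * (2 * t) = (2 * pi * t) *+ 2 :> R by rewrite -mulr_natl; ring.
by rewrite cos_mulr2n; ring.
Qed.

(** [P_double] passes from [r] to [r ^+ 2], of smaller modulus, so a bound in terms of [s] serves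
    all iterates at once. It comes from (1 - s)^2 <= q <= 4. *)
Let P_bound r s : `|r| <= s -> s < 1 -> `|P r| <= ln 4 - 2 * ln (1 - s).
Proof.
move=> rs s1; have r1 : `|r| < 1 by exact: le_lt_trans s1.
have s0 : 0 <= s by exact: le_trans rs.
have i01 : fine (mu `[0, 1]) = 1.
  by rewrite lebesgue_measure_itv/= lte_fin ltr01 oppr0 addr0.
set K := (X in _ <= X).
apply: (@le_trans _ _ (\int[mu]_(t in `[0, 1]) `|ln (q r t)|)).
  by apply: le_normr_Rintegral => //; exact: continuous_itv_integrable (continuous_lnq _).
apply: (@le_trans _ _ (\int[mu]_(t in `[0, 1]) K)); last first.
  by rewrite Rintegral_cst// i01 mulr1.
apply: le_Rintegral => //.
- apply: (continuous_itv_integrable (f := fun t => `|ln (q r t)|)) => x.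
  by apply: cvg_norm; exact: continuous_lnq.
- by apply: (continuous_itv_integrable (f := cst K)) => x; exact: cvg_cst.
- move=> t _; have l4 : 0 <= ln 4 :> R by rewrite ln_ge0// ler1n.
  have ls : ln (1 - s) <= 0 by rewrite ln_le0// gerBl.
  have ub : ln (q r t) <= ln 4 by rewrite ler_ln ?posrE ?q_gt0// q_ub.
  have lb : 2 * ln (1 - s) <= ln (q r t).
    rewrite mulr_natl -lnXn ?subr_gt0// ler_ln ?posrE ?q_gt0 ?exprn_gt0 ?subr_gt0//.
    rewrite (le_trans _ (q_lb r t))// lerXn2r ?nnegrE ?subr_ge0 ?(ltW s1) ?(ltW r1)//.
    by rewrite lerB.
  by rewrite ler_norml /K; apply/andP; split; lra.
Qed.

(* [P_double] gives [2 ^ n * P r = P (r ^+ (2 ^ n))], which [P_bound] keeps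
   bounded. *)
Lemma Rintegral_ln_circle r : `|r| < 1 ->
  \int[mu]_(t in `[0, 1]) ln (1 - 2 * r * cos (2 * pi * t) + r ^+ 2) = 0.
Proof.
move=> r1; rewrite -[LHS]/(P r); set K := ln 4 - 2 * ln (1 - `|r|).
have h n s : `|s| <= `|r| -> 2 ^+ n * `|P s| <= K.
  elim: n s => [|n IH] s sr; first by rewrite mul1r P_bound.
  have s1 : `|s| < 1 by exact: le_lt_trans r1.
  have -> : 2 ^+ n.+1 * `|P s| = 2 ^+ n * `|P s + P s|.
    by rewrite -mulr2n normrMn exprSr -mulrA mulr_natl.
  rewrite P_double// IH// normrX (le_trans _ sr)// expr2 ler_piMr// ltW//.
apply/eqP; rewrite -normr_le0 leNgt; apply/negP => P0.
have [n nK] : exists n : nat, K / `|P r| < n%:R.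
  by exists (Num.truncn (K / `|P r|)).+1; exact: truncnS_gt.
have := h n r (lexx _); apply/negP; rewrite -ltNge -ltr_pdivrMr// (lt_le_trans nK)//.
by rewrite -natrX ler_nat ltnW// ltn_expl.
Qed.

End circle_mean.

Section jensen.
Context {R : realType}.
Notation mu := (@lebesgue_measure R).

Definition lnabs (x : R) : \bar R := lne (`|x|)%:E.

Lemma lnabsE x : x != 0 -> lnabs x = (ln `|x|)%:E.
Proof. by move=> x0; rewrite /lnabs lne_EFin// normr_gt0. Qed.

Lemma lnabs0 : lnabs 0 = -oo%E.
Proof. by rewrite /lnabs normr0 le0_lneNy. Qed.

(** The value -oo at 0 makes this hold at zeros too, as +oo never occurs; factorisations of an
    integrand can thus be used at every point. *)
Lemma lnabsM x y : lnabs (x * y) = (lnabs x + lnabs y)%E.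
Proof.
have [->|x0] := eqVneq x 0; first by rewrite mul0r lnabs0 addNye.
have [->|y0] := eqVneq y 0; first by rewrite mulr0 lnabs0 addeNy.
by rewrite !lnabsE ?mulf_neq0// normrM lnM ?posrE ?normr_gt0.
Qed.

Lemma lnabsN x : lnabs (- x) = lnabs x.
Proof. by rewrite /lnabs normrN. Qed.

Lemma measurable_lnabs : measurable_fun [set: R] lnabs.
Proof.
have -> : lnabs = (fun x => if x == 0 then -oo%E else (ln `|x|)%:E).
  by apply/funext => x; case: eqVneq => [->|/lnabsE//]; exact: lnabs0.
apply: measurable_fun_ifT => //.
- exact: measurable_fun_eqr.
- apply/measurable_EFinP; apply: measurableT_comp; first exact: measurable_ln.
  exact: normr_measurable.
Qed.

(* As [Num.sqrt] is [0] on negative numbers, this is [ln (`|A| / 2)] when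
   [k < `|A|]. *)
Definition jensen (k A : R) : R :=
  ln ((Num.max k `|A| + Num.sqrt (k ^+ 2 - A ^+ 2)) / 2).

(** With S = sqrt (k^2 - A^2), c = (k + S) / 2 and r = - A / (k + S), one has k + A cos(2 pi t) = c
    |1 - r z|^2 and |r| < 1, so only ln c survives the mean over the circle. *)
Lemma integral_ln_cos_lt (k A : R) : `|A| < k ->
  (\int[mu]_(t in `[0%R, 1%R]) (ln (k + A * cos (2 * pi * t)))%:E = (jensen k A)%:E)%E.
Proof.
move=> Ak; have k0 : 0 < k by exact: le_lt_trans Ak.
have D0 : 0 < k ^+ 2 - A ^+ 2.
  by rewrite subr_gt0 -[A ^+ 2]ger0_norm ?sqr_ge0// normrX ltrXn2r ?nnegrE// ltW.
set S := Num.sqrt (k ^+ 2 - A ^+ 2).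
have S0 : 0 < S by rewrite sqrtr_gt0.
have S2 : S ^+ 2 = k ^+ 2 - A ^+ 2 by rewrite sqr_sqrtr// ltW.
have kS0 : k + S != 0 by rewrite gt_eqF// addr_gt0.
set r := - A / (k + S).
have r1 : `|r| < 1.
  rewrite normrM normrN normfV [`|k + S|]gtr0_norm ?addr_gt0//.
  by rewrite ltr_pdivrMr ?addr_gt0// mul1r (lt_trans Ak)// ltrDl.
set c := (k + S) / 2.
have c0 : 0 < c by rewrite divr_gt0// addr_gt0.
have jE : jensen k A = ln c by rewrite /jensen max_l// ltW.
have e t : k + A * cos (2 * pi * t) = c * (1 - 2 * r * cos (2 * pi * t) + r ^+ 2).
  have cr : 2 * c * r = - A by rewrite /c /r; field.
  have cr2 : c * (1 + r ^+ 2) = k.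
    apply: (mulfI kS0); transitivity (((k + S) ^+ 2 + A ^+ 2) / 2).
      by rewrite /c /r; field.
    have -> : A ^+ 2 = k ^+ 2 - S ^+ 2 by rewrite S2 opprB addrC subrK.
    by field.
  transitivity (c * (1 + r ^+ 2) - (2 * c * r) * cos (2 * pi * t)); last by ring.
  by rewrite cr cr2; ring.
have pos t : 0 < k + A * cos (2 * pi * t).
  have : - (A * cos (2 * pi * t)) <= `|A|.
    by rewrite (le_trans (ler_norm _))// normrN normrM ler_piMr// cos_max.
  by move: Ak; lra.
have cl : continuous (fun t => ln (1 - 2 * r * cos (2 * pi * t) + r ^+ 2)).
  move=> x; apply: (@continuous_ln_comp R (fun t => 1 - 2 * r * cos (2 * pi * t) + r ^+ 2)).
    by rewrite -(pmulr_rgt0 _ c0) -e.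
  apply: cvgD; last exact: cvg_cst.
  apply: cvgB; first exact: cvg_cst.
  by apply: cvgM; [exact: cvg_cst|exact: continuous_cos2pi].
have i1 : mu.-integrable `[0, 1] (EFin \o (fun=> ln c)).
  by apply: (continuous_itv_integrable (f := cst (ln c))) => x; exact: cvg_cst.
have i2 := @continuous_itv_integrable R _ 0 1 cl.
transitivity (\int[mu]_(t in `[0%R, 1%R])
   (ln c + ln (1 - 2 * r * cos (2 * pi * t) + r ^+ 2))%:E)%E.
  apply: eq_integral => t _; rewrite e lnM ?posrE//.
  by rewrite -(pmulr_rgt0 _ c0) -e.
have m01 : mu `[0, 1]%classic = 1%E.
  by rewrite lebesgue_measure_itv/= lte_fin ltr01 oppr0 adde0.
rewrite (integralD_EFin _ i1 i2)//= integral_cst// [X in (_ * X + _)%E]m01 mule1 jE.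
rewrite -[X in (_ + X)%E]fineK; last by apply: integrable_fin_num => //; exact: i2.
by have := Rintegral_ln_circle r1; rewrite /Rintegral => ->; rewrite adde0.
Qed.

End jensen.

(** * The mean of the logarithm of the sine *)

Section log_sine.
Context {R : realType}.
Notation mu := (@lebesgue_measure R).

Lemma sqr_2sinpi (t : R) : (2 * sin (pi * t)) ^+ 2 = 2 - 2 * cos (2 * pi * t).
Proof.
have -> : 2 * pi * t = (pi * t) *+ 2 :> R by rewrite -mulr_natl; ring.
by rewrite cos_mulr2n cos2sin2; ring.
Qed.

Lemma sinpi_gt0 (t : R) : 0 < t < 1 -> 0 < sin (pi * t).
Proof.
move=> /andP[t0 t1]; rewrite sin_gt0_pi//.
by rewrite mulr_gt0 ?pi_gt0//= gtr_pMr ?pi_gt0.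
Qed.

Lemma lebesgue_measure_01 : mu `[0, 1]%classic = 1%E.
Proof. by rewrite lebesgue_measure_itv/= lte_fin ltr01 oppr0 adde0. Qed.

(* [(2 * sin (pi * t)) ^+ 2 = 2 - 2 * cos (2 * pi * t)] is the limit of
   [a - 2 * cos (2 * pi * t)] as [a] decreases to [2]. *)
Lemma integral_sqr_log_sine :
  (\int[mu]_(t in `]0%R, 1%R[) (ln 5 - ln ((2 * sin (pi * t)) ^+ 2))%:E = (ln 5)%:E)%E.
Proof.
pose a n : R := 2 + n.+1%:R^-1.
have a2 n : 2 < a n by rewrite ltrDl invr_gt0.
have a3 n : a n <= 3.
  have : n.+1%:R^-1 <= 1 :> R by rewrite invf_le1// ler1n.
  by rewrite /a; move: (_^-1) => z; lra.
(* As [a n] is at most 3, the inner logarithm is at most ln 5, so [g n] is nonnegative; it increases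
   with [n], as monotone convergence requires. The open interval excludes the endpoints, where [g n]
   tends to infinity but [ln] of 0 has a finite default value. *)
pose g n t : R := ln 5 - ln (a n + -2 * cos (2 * pi * t)).
have pos n t : 0 < a n + -2 * cos (2 * pi * t).
  by have := cos_le1 (2 * pi * t); have := a2 n; lra.
have cg n : continuous (fun t => ln (a n + -2 * cos (2 * pi * t))).
  move=> x; apply: (@continuous_ln_comp R (fun t => a n + -2 * cos (2 * pi * t))) => //.
  apply: cvgD; first exact: cvg_cst.
  by apply: cvgM; [exact: cvg_cst|exact: continuous_cos2pi].
have cgn n : continuous (g n).
  by move=> x; apply: cvgB; [exact: cvg_cst|exact: cg].
have ig n : (\int[mu]_(t in `]0%R, 1%R[) (g n t)%:E = (ln 5 - jensen (a n) (-2))%:E)%E.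
  rewrite -(@integral_itv_bndoo _ _ _ _ true false); last first.
    apply: measurable_funTS; apply/measurable_EFinP.
    exact: continuous_measurable_fun.
  have i1 : mu.-integrable `[0, 1] (EFin \o (fun=> ln 5 : R)).
    by apply: (continuous_itv_integrable (f := cst (ln 5))) => x; exact: cvg_cst.
  have i2 := @continuous_itv_integrable R _ 0 1 (cg n).
  rewrite (integralB_EFin _ i1 i2)//= integral_cst// [X in (_ * X - _)%E]lebesgue_measure_01.
  rewrite mule1 integral_ln_cos_lt ?EFinB// normrN ger0_norm//.
have g0 n t : 0 <= g n t.
  rewrite subr_ge0 ler_ln ?posrE//.
  by have := cos_geN1 (2 * pi * t); have := a3 n; lra.
have gnd t : {homo g ^~ t : m n / (m <= n)%N >-> m <= n}.
  move=> m n mn; rewrite lerB// ler_ln ?posrE// lerD2r lerD2l.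
  by rewrite lef_pV2 ?posrE// ler_nat.
have acvg : a n @[n --> \oo] --> (2 : R).
  rewrite -[X in _ --> X]addr0; apply: cvgD; first exact: cvg_cst.
  exact: cvg_harmonic.
have mD : measurable (`]0, 1[%classic : set R) by exact: measurable_itv.
have mg n : measurable_fun (`]0, 1[ : set R) (fun t => (g n t)%:E).
  apply: measurable_funTS; apply/measurable_EFinP.
  exact: continuous_measurable_fun.
have pg n t : `]0, 1[%classic t -> (0 <= (g n t)%:E)%E by move=> _; rewrite lee_fin.
have ng t : `]0, 1[%classic t -> {homo (fun n => (g n t)%:E) : m n / (m <= n)%N >-> (m <= n)%E}.
  by move=> _ m n mn; rewrite lee_fin gnd.
have := @monotone_convergence _ _ _ mu _ mD _ mg pg ng.
under [X in _ = limn X -> _]eq_fun do rewrite ig.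
move=> mc; transitivity (limn (fun n => (ln 5 - jensen (a n) (-2))%:E)).
  rewrite -mc; apply: eq_integral => t; rewrite inE/= in_itv/= => t01.
  apply/esym/cvg_lim => //; apply: cvg_EFin; first exact: nearW.
  rewrite sqr_2sinpi; apply: cvgB; first exact: cvg_cst.
  apply: continuous_cvg.
    apply: continuous_ln; rewrite -sqr_2sinpi exprn_gt0// mulr_gt0//.
    exact: sinpi_gt0.
  rewrite -mulNr; apply: cvgD => //; exact: cvg_cst.
apply/cvg_lim => //; apply: cvg_EFin; first exact: nearW.
(* In the limit the square root vanishes, and [jensen 2 (-2)] is ln 1 = 0. *)
rewrite -[X in _ --> X]subr0; apply: cvgB; first exact: cvg_cst.
rewrite -[X in _ --> X]ln1.
apply: continuous_cvg; first exact: continuous_ln.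
rewrite [X in _ --> X](_ : 1 = (2 + Num.sqrt (2 ^+ 2 - (-2) ^+ 2)) * 2^-1); last first.
  by rewrite sqrrN subrr sqrtr0 addr0 divff.
apply: cvgM; last exact: cvg_cst.
apply: cvgD.
  rewrite (_ : (fun n => Num.max _ _) = a)//; apply/funext => n.
  by rewrite normrN ger0_norm// max_l// ltW.
apply: continuous_cvg; first exact: sqrt_continuous.
apply: cvgB; last exact: cvg_cst.
by rewrite expr2; apply: cvgM.
Qed.

End log_sine.

(** * Jensen's formula in the presence of zeros *)

Section jensen_cos.
Context {R : realType}.
Notation mu := (@lebesgue_measure R).
Local Notation D01 := (`[0, 1]%classic : set R).

Let mD01 : measurable D01. Proof. exact: measurable_itv. Qed.

Lemma integrable_cst01 (c : R) : mu.-integrable D01 (fun=> c%:E).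
Proof. by apply: (continuous_itv_integrable (f := cst c)) => x; exact: cvg_cst. Qed.

Lemma integral_cst01 (c : R) : (\int[mu]_(t in D01) c%:E = c%:E)%E.
Proof. by rewrite integral_cst// [X in (_ * X)%E]lebesgue_measure_01 mule1. Qed.

Lemma measurable_lnabs_comp (f : R -> R) : continuous f ->
  measurable_fun [set: R] (fun t => lnabs (f t)).
Proof.
move=> cf; apply: measurableT_comp; first exact: measurable_lnabs.
exact: continuous_measurable_fun.
Qed.

Let continuous_2sinpi : continuous (fun t : R => 2 * sin (pi * t)).
Proof.
move=> x; apply: cvgM; first exact: cvg_cst.
apply: continuous_comp; last exact: continuous_sin.
by apply: cvgM; [exact: cvg_cst|exact: cvg_id].
Qed.

Let s (t : R) := lnabs (2 * sin (pi * t)).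

Let ms : measurable_fun [set: R] s.
Proof. exact: measurable_lnabs_comp. Qed.

Let s1 t : s (t + 1) = s t.
Proof. by rewrite /s mulrDr mulr1 sinDpi mulrN lnabsN. Qed.

(** Since (2 sin)^2 <= 4 < 5, this is nonnegative, so the value of its integral already proves it
    integrable; [s] is then recovered from it. *)
Let w (t : R) : \bar R := ((ln 5)%:E - 2%:E * s t)%E.

Let mw : measurable_fun [set: R] w.
Proof.
apply: emeasurable_funB => //; apply: emeasurable_funM => //.
Qed.

Let integral_w : (\int[mu]_(t in D01) w t = (ln 5)%:E)%E.
Proof.
rewrite (@integral_itv_bndoo _ _ _ _ true false); last exact: measurable_funTS.
rewrite -integral_sqr_log_sine; apply: eq_integral => t.
rewrite inE/= in_itv/= => t01; have st := sinpi_gt0 t01.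
rewrite /w /s lnabsE ?mulf_neq0 ?gt_eqF// ger0_norm ?mulr_ge0 ?ltW//.
have -> : ln ((2 * sin (pi * t)) ^+ 2) = 2 * ln (2 * sin (pi * t)).
  by rewrite lnXn ?mulr_gt0// [RHS]mulr_natl.
by [].
Qed.

Let w_ge0 t : (0 <= w t)%E.
Proof.
rewrite /w /s; have [->|x0] := eqVneq (2 * sin (pi * t)) 0.
  by rewrite lnabs0 gt0_muleNy ?lte_fin//= ?leey.
rewrite lnabsE// -EFinM -EFinB lee_fin subr_ge0 mulr_natl -lnXn ?normr_gt0//.
rewrite ler_ln ?posrE ?exprn_gt0 ?normr_gt0// -normrX ger0_norm ?sqr_ge0//.
by rewrite sqr_2sinpi; have := cos_geN1 (2 * pi * t); lra.
Qed.

Let integrable_w : mu.-integrable D01 w.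
Proof.
apply/integrableP; split; first exact: measurable_funTS.
have -> : (\int[mu]_(t in D01) `|w t| = \int[mu]_(t in D01) w t)%E.
  by apply: eq_integral => t _; rewrite gee0_abs.
by rewrite integral_w ltry.
Qed.

Lemma integrable_log_sine c :
  mu.-integrable D01 (fun t => lnabs (2 * sin (pi * (t + c)))) /\
  (\int[mu]_(t in D01) lnabs (2 * sin (pi * (t + c))) = 0)%E.
Proof.
have sE t : s t = ((2^-1)%:E * ((ln 5)%:E - w t))%E.
  rewrite /w; case: (s t) => [x| |].
  - by congr EFin; field.
  - by rewrite gt0_muley ?lte_fin//= gt0_muley ?lte_fin ?invr_gt0.
  - by rewrite gt0_muleNy ?lte_fin//= gt0_muleNy ?lte_fin ?invr_gt0.
have is0 : mu.-integrable D01 s.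
  rewrite (funext sE); apply: integrableZl => //.
  by apply: integrableB => //; exact: integrable_cst01.
have i0 : (\int[mu]_(t in D01) s t = 0)%E.
  under eq_integral do rewrite sE.
  rewrite integralZl//; last by apply: integrableB => //; exact: integrable_cst01.
  rewrite integralB//; last exact: integrable_cst01.
  by rewrite integral_cst01 integral_w subee// mule0.
split; last by rewrite -i0 -[RHS](integral_periodic c).
apply/integrableP; split.
  apply: measurable_funTS; apply: measurable_lnabs_comp => x.
  apply: (@continuous_comp _ _ _ (fun t => t + c) (fun t => 2 * sin (pi * t))).
    by apply: cvgD; [exact: cvg_id|exact: cvg_cst].
  exact: continuous_2sinpi.
rewrite (@integral_periodic _ (fun t => `|s t|%E) c).
- by have /integrableP[] := is0.
- exact: measurableT_comp.
- by move=> t; rewrite s1.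
Qed.

(** When k <= |A|, choose [c] with k = - A cos(2 pi c). Then k + A cos(2 pi t) = -2 A sin(pi (t +
    c)) sin(pi (t - c)), and the logarithm of each factor 2 |sin| has mean 0, which leaves ln (|A| /
    2). The second hypothesis excludes k = A = 0, where the integrand is constantly -oo. *)
Lemma integral_lnabs_cos (k A : R) : 0 <= k -> `|A| < k \/ A != 0 ->
  mu.-integrable D01 (fun t => lnabs (k + A * cos (2 * pi * t))) /\
  (\int[mu]_(t in D01) lnabs (k + A * cos (2 * pi * t)) = (jensen k A)%:E)%E.
Proof.
move=> k0 kA; have [Ak|kleA] := ltP `|A| k.
  have pos t : 0 < k + A * cos (2 * pi * t).
    have : - (A * cos (2 * pi * t)) <= `|A|.
      by rewrite (le_trans (ler_norm _))// normrN normrM ler_piMr// cos_max.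
    by move: Ak; lra.
  have cf : continuous (fun t => k + A * cos (2 * pi * t)).
    move=> x; apply: cvgD; first exact: cvg_cst.
    by apply: cvgM; [exact: cvg_cst|exact: continuous_cos2pi].
  have e t : lnabs (k + A * cos (2 * pi * t)) = (ln (k + A * cos (2 * pi * t)))%:E.
    by rewrite lnabsE ?gt_eqF// gtr0_norm.
  rewrite (funext e); split; last exact: integral_ln_cos_lt.
  apply: (continuous_itv_integrable (f := fun t => ln (k + A * cos (2 * pi * t)))) => x.
  by apply: (@continuous_ln_comp R (fun t => k + A * cos (2 * pi * t))); [|exact: cf].
have {kA}A0 : A != 0 by case: kA => //; rewrite ltNge kleA.
have nA0 : 0 < `|A| by rewrite normr_gt0.
have kA1 : -1 <= - (k / A) <= 1.
  by rewrite -ler_norml normrN normrM normfV ler_pdivrMr// mul1r ger0_norm.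
pose c := acos (- (k / A)) / (2 * pi).
have pi0 : (pi : R) != 0 by rewrite gt_eqF// pi_gt0.
have cosc : A * cos (2 * pi * c) = - k.
  have -> : 2 * pi * c = acos (- (k / A)).
    by rewrite /c mulrC divfK// mulf_neq0.
  by rewrite acosK; [field|rewrite in_itv].
have e t : lnabs (k + A * cos (2 * pi * t)) =
    ((ln (`|A| / 2))%:E + (lnabs (2 * sin (pi * (t + c))) + lnabs (2 * sin (pi * (t - c)))))%E.
  have -> : k + A * cos (2 * pi * t) =
      - (A / 2) * ((2 * sin (pi * (t + c))) * (2 * sin (pi * (t - c)))).
    rewrite -[k]opprK -cosc !(mulrDr pi) sinD mulrN sinB.
    have -> : 2 * pi * c = (pi * c) *+ 2 :> R by rewrite -mulr_natl; ring.
    have -> : 2 * pi * t = (pi * t) *+ 2 :> R by rewrite -mulr_natl; ring.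
    rewrite !cos_mulr2n.
    have := sin2cos2 (pi * t); have := sin2cos2 (pi * c).
    set st := sin _; set ct := cos _; set sc := sin _; set cc := cos _ => E1 E2.
    transitivity (- (A / 2) * 4 * (ct ^+ 2 * sc ^+ 2 - cc ^+ 2 * st ^+ 2)).
      by rewrite E1 E2; field.
    by field.
  rewrite [LHS]lnabsM [X in (_ + X)%E = _]lnabsM lnabsN.
  rewrite [X in (X + _)%E = _]lnabsE ?mulf_neq0 ?invr_neq0//.
  by rewrite normrM (@ger0_norm _ 2^-1).
have [ip i0] := integrable_log_sine c; have [im im0] := integrable_log_sine (- c).
have ipm : mu.-integrable D01
    (fun t => lnabs (2 * sin (pi * (t + c))) + lnabs (2 * sin (pi * (t - c))))%E.
  exact: integrableD.
rewrite (funext e); split.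
  by apply: integrableD => //; exact: integrable_cst01.
rewrite integralD//; last exact: integrable_cst01.
rewrite integralD// i0 im0 !adde0 integral_cst01; congr (ln (_ / _))%:E.
rewrite /jensen max_r// ler0_sqrtr ?addr0// subr_le0.
by rewrite -[A ^+ 2]ger0_norm ?sqr_ge0// normrX lerXn2r// nnegrE.
Qed.

End jensen_cos.

(** * The Mahler measure as a one-dimensional integral *)

Section torus.
Context {R : realType}.
Notation mu := (@lebesgue_measure R).
Local Notation D01 := (`[0, 1]%classic : set R).

Lemma continuous_jensen (k A : R -> R) (x : R) :
  0 < Num.max (k x) `|A x| -> {for x, continuous k} -> {for x, continuous A} ->
  {for x, continuous (fun t => jensen (k t) (A t))}.
Proof.
move=> m0 ck cA.
apply: (@continuous_ln_comp R
  (fun t => (Num.max (k t) `|A t| + Num.sqrt (k t ^+ 2 - A t ^+ 2)) / 2)).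
  by rewrite divr_gt0// ltr_wpDr// sqrtr_ge0.
apply: cvgM; last exact: cvg_cst.
apply: cvgD.
  apply: (@continuous_max R R k (fun t => `|A t|)) => //.
  exact: cvg_norm.
apply: continuous_comp; last exact: sqrt_continuous.
apply: cvgB.
  by apply: (@continuous_comp _ _ _ k (fun z => z ^+ 2)) => //; exact: exprn_continuous.
by apply: (@continuous_comp _ _ _ A (fun z => z ^+ 2)) => //; exact: exprn_continuous.
Qed.

(** Tonelli's theorem on the plane, applied to the extension of [g] by 0 outside the unit square. *)
Lemma ge0_fubini01 (g : R * R -> \bar R) : measurable_fun [set: R * R] g ->
  (forall z, 0 <= g z)%E ->
  (\int[mu]_(x in D01) \int[mu]_(y in D01) g (x, y) =
   \int[mu]_(y in D01) \int[mu]_(x in D01) g (x, y))%E.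
Proof.
move=> mg g0; pose h := g \_ (D01 `*` D01).
have mD : measurable D01 by exact: measurable_itv.
have mh : measurable_fun [set: R * R] h.
  apply/(measurable_restrictT _ _).1; first exact: measurableX.
  exact: measurable_funTS.
have h0 z : (0 <= h z)%E by rewrite /h /patch; case: ifP.
transitivity (\int[mu]_x \int[mu]_y h (x, y))%E.
  rewrite integral_mkcond; apply: eq_integral => x _.
  rewrite /patch; case: ifPn => xD.
    rewrite integral_mkcond; apply: eq_integral => y _.
    by rewrite /h /patch in_setX xD.
  rewrite -[LHS](integral0 mu setT); apply: eq_integral => y _.
  by rewrite /h /patch in_setX (negbTE xD).
transitivity (\int[mu]_y \int[mu]_x h (x, y))%E.
  exact: (@fubini_tonelli _ _ _ _ R mu mu h).
apply/esym; rewrite integral_mkcond; apply: eq_integral => y _.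
rewrite /patch; case: ifPn => yD.
  rewrite integral_mkcond; apply: eq_integral => x _.
  by rewrite /h /patch in_setX yD andbT.
rewrite -[LHS](integral0 mu setT); apply: eq_integral => x _.
by rewrite /h /patch in_setX (negbTE yD) andbF.
Qed.

End torus.

Section mahler_jensen.
Context {R : realType}.
Notation mu := (@lebesgue_measure R).
Local Notation D01 := (`[0, 1]%classic : set R).

Lemma integral_lnabs_cos_sym (c A : R) : A != 0 ->
  mu.-integrable D01 (fun t => lnabs (A * cos (2 * pi * t) + c)) /\
  (\int[mu]_(t in D01) lnabs (A * cos (2 * pi * t) + c) = (jensen `|c| A)%:E)%E.
Proof.
move=> A0; have [c0|c0] := leP 0 c.
  have -> : (fun t => lnabs (A * cos (2 * pi * t) + c)) =
      (fun t => lnabs (c + A * cos (2 * pi * t))).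
    by apply/funext => t; rewrite addrC.
  by rewrite ger0_norm//; exact: integral_lnabs_cos c0 (or_intror A0).
have Nc0 : 0 <= - c by rewrite oppr_ge0 ltW.
have NA0 : - A != 0 by rewrite oppr_eq0.
have -> : (fun t => lnabs (A * cos (2 * pi * t) + c)) =
    (fun t => lnabs (- c + - A * cos (2 * pi * t))).
  by apply/funext => t; rewrite -lnabsN; congr lnabs; ring.
have -> : jensen `|c| A = jensen (- c) (- A) by rewrite /jensen ltr0_norm// normrN !sqrrN.
exact: integral_lnabs_cos Nc0 (or_intror NA0).
Qed.

Lemma lnabs_le (x y : R) : 0 < y -> `|x| <= y -> (lnabs x <= (ln y)%:E)%E.
Proof.
move=> y0 xy; have [->|x0] := eqVneq x 0; first by rewrite lnabs0 leNye.
by rewrite lnabsE// lee_fin ler_ln ?posrE ?normr_gt0.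
Qed.

Lemma integral_cst01B (c : R) (f : R -> R) : mu.-integrable D01 (EFin \o f) ->
  (\int[mu]_(t in D01) (c - f t)%:E = c%:E - \int[mu]_(t in D01) (f t)%:E)%E.
Proof.
move=> fi; have ci : mu.-integrable D01 (EFin \o (fun=> c)) := integrable_cst01 c.
by rewrite (integralB_EFin _ ci fi)//= integral_cst01.
Qed.

Lemma integral_cst01_sube (c : R) (f : R -> \bar R) : mu.-integrable D01 f ->
  (\int[mu]_(t in D01) (c%:E - f t) = c%:E - \int[mu]_(t in D01) f t)%E.
Proof.
move=> fi; have ci : mu.-integrable D01 (fun=> c%:E) := integrable_cst01 c.
by rewrite (integralB _ ci fi)//= integral_cst01.
Qed.

Lemma fin_subeI (c : R) (x y : \bar R) : x \is a fin_num -> y \is a fin_num ->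
  (c%:E - x = c%:E - y)%E -> x = y.
Proof. by case: x y => [x| |] [y| |]//= _ _ []/addrI/oppr_inj ->. Qed.

(* By periodicity [t1] may be replaced by [t1 - t2] in the inner integral; after
   exchanging the integrals, a shift of [t2] removes [t1] from the inner
   cosine.  [M - _] makes the integrand nonnegative for Tonelli's theorem. *)
Lemma torus_integral (k : R) : 0 < k ->
  (\int[mu]_(t2 in D01) \int[mu]_(t1 in D01)
     lnabs (2 * cos (2 * pi * t1) + 2 * cos (2 * pi * t2) + k) =
   \int[mu]_(t in D01) (jensen k (4 * cos (pi * t)))%:E)%E.
Proof.
move=> k0; set M := ln (4 + k); have two_neq0 : (2 : R) != 0 by [].
(* The first factor is the product form of 2 cos(2 pi (t1 - t2)) + 2 cos(2 pi t2). For fixed [t1],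
   only one cosine depends on [t2]. *)
pose F (t1 t2 : R) := lnabs (4 * cos (pi * t1) * cos (pi * t1 - 2 * pi * t2) + k).
have mD : measurable D01 by exact: measurable_itv.
have cc : continuous (fun t : R => cos (pi * t)).
  move=> x; apply: continuous_comp; last exact: continuous_cos.
  by apply: cvgM; [exact: cvg_cst|exact: cvg_id].
have shiftE t2 :
    mu.-integrable D01 (F ^~ t2) /\
    (\int[mu]_(t1 in D01) F t1 t2 = (jensen `|2 * cos (2 * pi * t2) + k| 2)%:E)%E.
  pose f (t1 : R) := lnabs (2 * cos (2 * pi * t1) + (2 * cos (2 * pi * t2) + k)).
  have [fi fE] := @integral_lnabs_cos_sym (2 * cos (2 * pi * t2) + k) 2 two_neq0.
  have Ff t1 : F t1 t2 = f (t1 - t2).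
    have e x z : 4 * cos x * cos z = 2 * cos (x + z) + 2 * cos (x - z) :> R.
      by rewrite cosD cosB; ring.
    rewrite /F /f addrA e; congr (lnabs (2 * cos _ + 2 * cos _ + k)); ring.
  have mf : measurable_fun [set: R] f.
    apply: measurable_lnabs_comp => x; apply: cvgD; last exact: cvg_cst.
    by apply: cvgM; [exact: cvg_cst|exact: continuous_cos2pi].
  have f1 t : f (t + 1) = f t by rewrite /f cos2piD1.
  have -> : F ^~ t2 = (fun t1 => f (t1 - t2)) by apply/funext => t1; exact: Ff.
  split; last by rewrite integral_periodic.
  apply/integrableP; split.
    apply: measurable_funTS; apply: (measurableT_comp mf).
    by apply: continuous_measurable_fun => x; apply: cvgB; [exact: cvg_id|exact: cvg_cst].
  rewrite (@integral_periodic _ (fun t => `|f t|%E) (- t2)).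
  - by have /integrableP[] := fi.
  - exact: measurableT_comp.
  - by move=> t; rewrite f1.
have innerE t1 :
    mu.-integrable D01 (F t1) /\
    (\int[mu]_(t2 in D01) F t1 t2 = (jensen k (4 * cos (pi * t1)))%:E)%E.
  set A := 4 * cos (pi * t1).
  pose f (t2 : R) := lnabs (k + A * cos (2 * pi * t2)).
  have kA : `|A| < k \/ A != 0.
    by have [->|] := eqVneq A 0; [left; rewrite normr0|right].
  have [fi fE] := integral_lnabs_cos (ltW k0) kA.
  have Ff t2 : F t1 t2 = f (t2 - t1 / 2).
    rewrite /F /f addrC -[cos (pi * t1 - _)]cosN; congr (lnabs (_ + _ * cos _)).
    by field.
  have mf : measurable_fun [set: R] f.
    apply: measurable_lnabs_comp => x; apply: cvgD; first exact: cvg_cst.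
    by apply: cvgM; [exact: cvg_cst|exact: continuous_cos2pi].
  have f1 t : f (t + 1) = f t by rewrite /f cos2piD1.
  have -> : F t1 = (fun t2 => f (t2 - t1 / 2)) by apply/funext => t2; exact: Ff.
  split; last by rewrite integral_periodic.
  apply/integrableP; split.
    apply: measurable_funTS; apply: (measurableT_comp mf).
    by apply: continuous_measurable_fun => x; apply: cvgB; [exact: cvg_id|exact: cvg_cst].
  rewrite (@integral_periodic _ (fun t => `|f t|%E) (- (t1 / 2))).
  - by have /integrableP[] := fi.
  - exact: measurableT_comp.
  - by move=> t; rewrite f1.
pose g (z : R * R) : \bar R := (M%:E - F z.1 z.2)%E.
have g0 z : (0 <= g z)%E.
  rewrite /g sube_ge0; last by rewrite orbT.
  apply: lnabs_le; first by rewrite addr_gt0.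
  rewrite (le_trans (ler_normD _ _))// (gtr0_norm k0) lerD2r !normrM.
  rewrite (@ger0_norm _ 4)// -mulrA ler_piMr// mulr_ile1//; exact: cos_max.
have mg : measurable_fun [set: R * R] g.
  apply: emeasurable_funB => //; apply: measurableT_comp; first exact: measurable_lnabs.
  have mc : measurable_fun [set: R] (@cos R).
    by apply: continuous_measurable_fun; exact: continuous_cos.
  have m1 : measurable_fun [set: R * R] (fun z : R * R => pi * z.1).
    by apply: measurable_funM => //; exact: measurable_fst.
  have m2 : measurable_fun [set: R * R] (fun z : R * R => 2 * pi * z.2).
    by apply: measurable_funM => //; exact: measurable_snd.
  apply: measurable_funD => //; apply: measurable_funM.
    by apply: measurable_funM => //; apply: measurableT_comp.
  by apply: measurableT_comp => //; exact: measurable_funB.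
have tonelli := ge0_fubini01 mg g0.
have cj1 : continuous (fun t2 => jensen `|2 * cos (2 * pi * t2) + k| 2).
  move=> x; apply: (@continuous_jensen _ (fun t2 => `|2 * cos (2 * pi * t2) + k|) (cst 2)).
  - by rewrite lt_max orbC /= normr_gt0 two_neq0.
  - apply: cvg_norm; apply: cvgD; last exact: cvg_cst.
    by apply: cvgM; [exact: cvg_cst|exact: continuous_cos2pi].
  - exact: cvg_cst.
have cj2 : continuous (fun t => jensen k (4 * cos (pi * t))).
  move=> x; apply: (@continuous_jensen _ (cst k) (fun t => 4 * cos (pi * t))).
  - by rewrite lt_max k0.
  - exact: cvg_cst.
  - by apply: cvgM; [exact: cvg_cst|exact: cc].
have i1 := continuous_itv_integrable 0 1 cj1.
have i2 := continuous_itv_integrable 0 1 cj2.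
have LE : (\int[mu]_(y in D01) \int[mu]_(x in D01) g (x, y) =
    M%:E - \int[mu]_(t2 in D01) (jensen `|2 * cos (2 * pi * t2) + k| 2)%:E)%E.
  transitivity (\int[mu]_(t2 in D01) (M - jensen `|2 * cos (2 * pi * t2) + k| 2)%:E)%E; last first.
    by rewrite (integral_cst01B _ i1).
  apply: eq_integral => t2 _; have [Fi FE] := shiftE t2.
  by rewrite EFinB -FE; exact: integral_cst01_sube.
have RE : (\int[mu]_(x in D01) \int[mu]_(y in D01) g (x, y) =
    M%:E - \int[mu]_(t in D01) (jensen k (4 * cos (pi * t)))%:E)%E.
  transitivity (\int[mu]_(t in D01) (M - jensen k (4 * cos (pi * t)))%:E)%E; last first.
    by rewrite (integral_cst01B _ i2).
  apply: eq_integral => t _; have [Fi FE] := innerE t.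
  by rewrite EFinB -FE; exact: integral_cst01_sube.
transitivity (\int[mu]_(t2 in D01) (jensen `|2 * cos (2 * pi * t2) + k| 2)%:E)%E.
  apply: eq_integral => t2 _.
  have [_ <-] := @integral_lnabs_cos_sym (2 * cos (2 * pi * t2) + k) 2 two_neq0.
  by apply: eq_integral => t1 _; rewrite addrA.
have E := etrans (esym RE) (etrans tonelli LE).
(* Both integrals are finite, so the bound [M] cancels. *)
apply: (@fin_subeI M); [| |exact: esym E].
- by apply: integrable_fin_num => //; exact: i1.
- by apply: integrable_fin_num => //; exact: i2.
Qed.

Lemma mahler_m_jensen (k : R) : 0 < k ->
  (mahler_m (k%:C)%C = \int[mu]_(t in D01) (jensen k (4 * cos (pi * t)))%:E)%E.
Proof.
move=> k0; apply: (etrans _ (torus_integral k0)); rewrite /mahler_m /mahler_measure.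
apply: eq_integral => t2 _; apply: eq_integral => t1 _; rewrite /lnabs; congr (lne _%:E).
have eV (t : R) : (expi2pi t)^-1 = (cos (2 * pi * t) -i* sin (2 * pi * t))%C.
  rewrite /expi2pi /GRing.inv/= cos2Dsin2 !divr1//.
rewrite /laurentP !eV /expi2pi /Normc.normc/=.
set a := cos _; set b := sin _; set c := cos _; set d := sin _.
rewrite (_ : b + - b + d + - d + 0 = 0); last by ring.
by rewrite expr0n/= addr0 sqrtr_sqr; congr `|_|; ring.
Qed.

End mahler_jensen.

(** * Primitives of the logarithmic sine and of the Jensen function *)

Section primitive.
Context {R : realType}.
Notation mu := (@lebesgue_measure R).

(** The integral of [f] from 0 to [x], rescaled so that the earlier integrals over [0, 1] of
    functions of [pi * t] are values at [pi]. It is 0 for negative [x], where the interval is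
    empty. *)
Definition primitive (f : R -> R) (x : R) : R :=
  pi * \int[mu]_(t in `[0, x / pi]) f (pi * t).

Lemma primitive0 f : primitive f 0 = 0.
Proof. by rewrite /primitive mul0r set_itv1 Rintegral_set1 mulr0. Qed.

Let pi_neq0 : (pi : R) != 0. Proof. by rewrite gt_eqF ?pi_gt0. Qed.

(** The integrand is extended by 0 to some [a, b] with a < 0, which makes x / pi an interior point.
    Continuity at 0 and at negative [x] is thus covered, and the endpoints of the curves need no
    separate treatment. *)
Lemma continuous_primitive (f : R -> R) (b x : R) : x < pi * b ->
  mu.-integrable `[0, b] (EFin \o (fun t => f (pi * t))) ->
  {for x, continuous (primitive f)}.
Proof.
move=> xb fi; set g := fun t => f (pi * t).
have xb' : x / pi < b by rewrite ltr_pdivrMr ?pi_gt0// mulrC.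
pose a := Num.min 0 (x / pi) - 1.
have a0 : a < 0 by rewrite /a ltrBlDr add0r gt_min ltr01.
have ax : a < x / pi.
  rewrite /a ltrBlDr; apply: (@le_lt_trans _ _ (x / pi)); last by rewrite ltrDl.
  by rewrite ge_min lexx orbT.
have gi : mu.-integrable `[a, b] (EFin \o (g \_ `[0, b])).
  rewrite -restrict_EFin; apply/integrable_restrict => //.
  rewrite setIidr// => t/=; rewrite !in_itv/= => /andP[t0 ->].
  by rewrite (le_trans (ltW a0)).
have cG : {for x / pi, continuous (fun y => \int[mu]_(t in `[a, y]) (g \_ `[0, b]) t)}.
  have := parameterized_integral_continuous (ltW (lt_trans ax xb')) gi.
  by move=> /(within_continuous_continuous (lt_trans ax xb')); apply; rewrite in_itv/= ax.
have nE : {near x, (fun y => pi * \int[mu]_(t in `[a, y / pi]) (g \_ `[0, b]) t) =1 primitive f}.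
  near=> y; congr (pi * _).
  have yb : y / pi < b.
    by rewrite ltr_pdivrMr ?pi_gt0// mulrC; near: y; exact: lt_nbhsl.
  rewrite -Rintegral_mkcondr; congr (Rintegral _ _ _).
  apply/seteqP; split => t/=; rewrite !in_itv/=.
    by move=> [/andP[_ ->] /andP[->]].
  move=> /andP[t0 ty]; rewrite t0 ty (le_trans (ltW a0))//=; split => //.
  by rewrite (le_trans ty)// ltW.
have Ex := nbhs_singleton nE.
apply: (cvg_trans (near_eq_cvg nE)); rewrite -Ex.
apply: cvgM; first exact: cvg_cst.
have cd : (y / pi) @[y --> x] --> x / pi.
  by apply: cvgM; [exact: cvg_id|exact: cvg_cst].
exact: (cvg_comp _ _ cd cG).
Unshelve. all: by end_near. Qed.

Lemma is_derive_primitive (f : R -> R) (b x : R) : 0 < x < pi * b ->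
  mu.-integrable `[0, b] (EFin \o (fun t => f (pi * t))) ->
  {for x, continuous f} -> is_derive x 1 (primitive f) (f x).
Proof.
move=> /andP[x0 xb] fi cf; set g := fun t => f (pi * t).
have xb' : x / pi < b by rewrite ltr_pdivrMr ?pi_gt0// mulrC.
have x0' : 0 < x / pi by rewrite divr_gt0 ?pi_gt0.
have xE : pi * (x / pi) = x by rewrite mulrC divfK.
have cg : {for x / pi, continuous g}.
  apply: (@continuous_comp _ _ _ (fun y => pi * y)); last by rewrite xE.
  by apply: cvgM; [exact: cvg_cst|exact: cvg_id].
have [dG GE] := continuous_FTC1_closed xb' fi x0' cg.
set G := (fun x : R => \int[mu]_(t in `[0, x]) g t) in dG GE *.
have dG' : is_derive (x / pi) 1 G (f x).
  by apply: DeriveDef => //; rewrite -derive1E GE /g xE.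
have d1 : is_derive x 1 (fun y : R => y / pi) pi^-1.
  by apply: is_derive_eq; rewrite /GRing.scale/= ?(mulr1,mulr0,add0r,addr0).
have d2 := @is_derive1_comp R G (fun y => y / pi) x _ _ dG' d1.
have -> : primitive f = (fun y => pi * (G \o (fun y : R => y / pi)) y) by [].
apply: is_derive_eq; rewrite /GRing.scale/=.
by rewrite mulrC divfK.
Qed.

End primitive.

Section lobachevsky.
Context {R : realType}.
Notation mu := (@lebesgue_measure R).

Let pi_neq0 : (pi : R) != 0. Proof. by rewrite gt_eqF ?pi_gt0. Qed.

Lemma is_derive_compE (f g : R -> R) (x a b : R) :
  is_derive (g x) 1 f a -> is_derive x 1 g b -> is_derive x 1 (fun y => f (g y)) (a * b).
Proof. exact: is_derive1_comp. Qed.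

Lemma is_derive0_itv (f : R -> R) (a b : R) : a < b ->
  (forall x, a < x < b -> is_derive x 1 f 0) ->
  (forall x, a <= x <= b -> {for x, continuous f}) -> f a = f b.
Proof.
move=> ab f0 fc.
have d x : x \in `]a, b[ -> is_derive x 1 f (cst 0 x) by rewrite in_itv/= => /f0.
have c : {within `[a, b], continuous f}.
  by apply: continuous_in_subspaceT => x; rewrite inE/= in_itv/=; exact: fc.
by have [y _ /eqP] := MVT ab d c; rewrite mul0r subr_eq0 => /eqP.
Qed.

Lemma integrable_ln_sine01 : mu.-integrable `[0, 1] (EFin \o (fun t => ln (2 * sin (pi * t)))).
Proof.
have ml : measurable_fun [set: R] (fun t : R => ln (2 * sin (pi * t))).
  apply: measurableT_comp; first exact: measurable_ln.
  apply: continuous_measurable_fun => x; apply: cvgM; first exact: cvg_cst.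
  apply: continuous_comp; last exact: continuous_sin.
  by apply: cvgM; [exact: cvg_cst|exact: cvg_id].
apply/integrableP; split; first by apply: measurable_funTS; exact/measurable_EFinP.
rewrite (@integral_itv_bndoo _ _ _ _ true false); last first.
  by apply: measurable_funTS; apply: measurableT_comp => //; exact/measurable_EFinP.
have [/integrableP[_ +] _] := @integrable_log_sine R 0.
rewrite (@integral_itv_bndoo _ _ _ _ true false); last first.
  apply: measurable_funTS; apply: measurableT_comp => //; apply: measurable_lnabs_comp => x.
  apply: cvgM; first exact: cvg_cst.
  apply: continuous_comp; last exact: continuous_sin.
  apply: cvgM; first exact: cvg_cst.
  by apply: cvgD; [exact: cvg_id|exact: cvg_cst].
congr (_ < _)%E; apply: eq_integral => t; rewrite inE/= in_itv/= => t01.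
have st := sinpi_gt0 t01.
by rewrite addr0 lnabsE ?mulf_neq0 ?gt_eqF// ger0_norm// mulr_ge0// ltW.
Qed.

(* Minus the Lobachevsky function, on [0, pi]. *)
Definition Lam : R -> R := primitive (fun t => ln (2 * sin t)).

Lemma Lam0 : Lam 0 = 0. Proof. exact: primitive0. Qed.

Lemma continuous_Lam (x : R) : x < pi -> {for x, continuous Lam}.
Proof.
by move=> xpi; apply: (@continuous_primitive _ _ 1); rewrite ?mulr1//; exact: integrable_ln_sine01.
Qed.

Lemma is_derive_Lam (x : R) : 0 < x < pi -> is_derive x 1 Lam (ln (2 * sin x)).
Proof.
move=> /andP[x0 xpi]; apply: (@is_derive_primitive _ (fun t => ln (2 * sin t)) 1).
- by rewrite mulr1 x0.
- exact: integrable_ln_sine01.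
- apply: (@continuous_ln_comp R (fun t => 2 * sin t)).
    by rewrite mulr_gt0// sin_gt0_pi// x0.
  by apply: cvgM; [exact: cvg_cst|exact: continuous_sin].
Qed.

Lemma continuous_Lam_comp (f : R -> R) (x : R) : f x < pi -> {for x, continuous f} ->
  {for x, continuous (fun y => Lam (f y))}.
Proof. by move=> fx cf; apply: continuous_comp => //; exact: continuous_Lam. Qed.

(* From the duplication formula
   [Lam (2 * x) = 2 * Lam x - 2 * Lam (pi / 2 - x) + 2 * Lam (pi / 2)] at
   [x = pi / 4]. *)
Lemma Lam_pihalf : Lam (pi / 2) = 0.
Proof.
have pi0 := @pi_gt0 R.
pose N x := Lam (2 * x) - 2 * Lam x + 2 * Lam (pi / 2 - x).
have N0 : N 0 = N (pi / 4).
  apply: is_derive0_itv.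
  - by rewrite divr_gt0.
  - move=> x /andP[x0 x4].
    have d1 : is_derive x 1 (fun x => 2 * x) (2 : R).
      by apply: is_derive_eq; rewrite /GRing.scale/= ?(mulr1,mulr0,add0r,addr0).
    have d2 : is_derive x 1 (fun x => pi / 2 - x) (-1 : R).
      by apply: is_derive_eq; ring.
    have r1 : 0 < 2 * x < pi by lra.
    have r2 : 0 < x < pi by lra.
    have r3 : 0 < pi / 2 - x < pi by lra.
    have e1 := @is_derive_compE Lam _ _ _ _ (is_derive_Lam r1) d1.
    have e2 := is_derive_Lam r2.
    have e3 := @is_derive_compE Lam (fun x => pi / 2 - x) _ _ _ (is_derive_Lam r3) d2.
    apply: is_derive_eq; rewrite /GRing.scale/=.
    have -> : sin (pi / 2 - x) = cos x.
      by rewrite sinB sin_pihalf cos_pihalf mul1r mul0r subr0.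
    have -> : 2 * x = x *+ 2 by rewrite mulr_natl.
    have sx : 0 < sin x by rewrite sin_gt0_pi.
    have cx : 0 < cos x by rewrite cos_gt0_pihalf//; lra.
    have -> : 2 * (sin (x *+ 2)) = (2 * sin x) * (2 * cos x).
      by rewrite sin_mulr2n -[_ *+ 2]mulr_natl; ring.
    rewrite lnM ?posrE ?mulr_gt0//; ring.
  - move=> x /andP[x0 x4].
    have c2 : {for x, continuous (fun x : R => 2 * x)}.
      by apply: cvgM; [exact: cvg_cst|exact: cvg_id].
    have c3 : {for x, continuous (fun x : R => pi / 2 - x)}.
      by apply: cvgB; [exact: cvg_cst|exact: cvg_id].
    apply: cvgD.
      apply: cvgB; first by apply: (continuous_Lam_comp _ c2); lra.
      by apply: cvgM; [exact: cvg_cst|apply: continuous_Lam; lra].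
    by apply: cvgM; [exact: cvg_cst|apply: (continuous_Lam_comp _ c3); lra].
move: N0; rewrite /N !(mulr0, Lam0, subr0).
have -> : 2 * (pi / 4) = pi / 2 :> R by field.
have -> : pi / 2 - pi / 4 = pi / 4 :> R by field.
lra.
Qed.

(** * The primitive of the Jensen function and its value at pi/2 *)

Section jensen_primitive.
Variables (k : R).
Hypothesis k0 : 0 < k.

Definition Jen : R -> R := primitive (fun t => jensen k (4 * sin t)).

Lemma Jen0 : Jen 0 = 0. Proof. exact: primitive0. Qed.

Lemma continuous_jensen_sin : continuous (fun t : R => jensen k (4 * sin t)).
Proof.
move=> x; apply: (@continuous_jensen _ (cst k) (fun t => 4 * sin t)).
- by rewrite lt_max k0.
- exact: cvg_cst.
- by apply: cvgM; [exact: cvg_cst|exact: continuous_sin].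
Qed.

Lemma integrable_jensen_sin (b : R) :
  mu.-integrable `[0, b] (EFin \o (fun t => jensen k (4 * sin (pi * t)))).
Proof.
apply: continuous_itv_integrable => x.
apply: (@continuous_comp _ _ _ (fun t => pi * t) (fun t => jensen k (4 * sin t))).
  by apply: cvgM; [exact: cvg_cst|exact: cvg_id].
exact: continuous_jensen_sin.
Qed.

Lemma continuous_Jen : continuous Jen.
Proof.
move=> x; apply: (@continuous_primitive _ _ (x / pi + 1)); last exact: integrable_jensen_sin.
by rewrite mulrDr mulrC divfK// mulr1 ltrDl pi_gt0.
Qed.

Lemma is_derive_Jen (x : R) : 0 < x -> is_derive x 1 Jen (jensen k (4 * sin x)).
Proof.
move=> x0; apply: (@is_derive_primitive _ (fun t => jensen k (4 * sin t)) (x / pi + 1)).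
- by rewrite x0 mulrDr mulrC divfK// mulr1 ltrDl pi_gt0.
- exact: integrable_jensen_sin.
- exact: continuous_jensen_sin.
Qed.

(** The symmetry t -> pi - t of the sine, expressed as the constancy of [N]. *)
Lemma Jen_pi : Jen pi = 2 * Jen (pi / 2).
Proof.
have pi0 := @pi_gt0 R.
pose N x := Jen x + Jen (pi - x).
have N0 : N 0 = N (pi / 2).
  apply: is_derive0_itv.
  - by rewrite divr_gt0.
  - move=> x /andP[x0 x2].
    have d2 : is_derive x 1 (fun x => pi - x) (-1 : R).
      by apply: is_derive_eq; ring.
    have r : 0 < pi - x by lra.
    have e1 := is_derive_Jen x0.
    have e2 := @is_derive_compE Jen (fun x => pi - x) _ _ _ (is_derive_Jen r) d2.
    apply: is_derive_eq.
    have -> : sin (pi - x) = sin x by rewrite sinB sinpi cospi mul0r mulN1r sub0r opprK.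
    by rewrite mulrN1 subrr.
  - move=> x _; apply: cvgD; first exact: continuous_Jen.
    apply: (@continuous_comp _ _ _ (fun x => pi - x) Jen); last exact: continuous_Jen.
    by apply: cvgB; [exact: cvg_cst|exact: cvg_id].
move: N0; rewrite /N Jen0 subr0 add0r => ->.
have -> : pi - pi / 2 = pi / 2 :> R by field.
by ring.
Qed.

(** Since [jensen k] is even, its value at 4 cos(pi t) has period 1 in [t], and a shift by 1/2 turns
    the cosine into a sine. *)
Lemma mahler_m_Jen : (mahler_m (k%:C)%C = (2 / pi * Jen (pi / 2))%:E)%E.
Proof.
rewrite mahler_m_jensen//.
have c1 : continuous (fun t : R => jensen k (4 * cos (pi * t))).
  move=> x; apply: (@continuous_jensen _ (cst k) (fun t => 4 * cos (pi * t))).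
  - by rewrite lt_max k0.
  - exact: cvg_cst.
  - apply: cvgM; first exact: cvg_cst.
    apply: continuous_comp; last exact: continuous_cos.
    by apply: cvgM; [exact: cvg_cst|exact: cvg_id].
have jN A : jensen k (- A) = jensen k A by rewrite /jensen normrN sqrrN.
have e := @integral_periodic R (fun t => (jensen k (4 * cos (pi * t)))%:E) 2^-1 _ _.
rewrite -e; last 2 first.
- by apply/measurable_EFinP; exact: continuous_measurable_fun.
- by move=> t; rewrite mulrDr mulr1 cosDpi mulrN jN.
have -> : 2 / pi * Jen (pi / 2) = \int[mu]_(t in `[0, 1]) jensen k (4 * sin (pi * t)).
  rewrite mulrAC -Jen_pi /Jen /primitive divff// mulrC mulKf//.
rewrite /Rintegral fineK; last first.
  by apply: integrable_fin_num => //; exact: integrable_jensen_sin.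
apply: eq_integral => t _; congr EFin.
by rewrite mulrDr cosDpihalf mulrN jN.
Qed.

(* Beyond [x] one has [jensen k (4 * sin t) = ln (2 * sin t)], the integrand of
   [Lam]. *)
Lemma Jen_sub_Lam (x : R) : 0 <= x <= pi / 2 -> 4 * sin x = k ->
  Jen x - Lam x = Jen (pi / 2).
Proof.
move=> /andP[x0 xpi2] sx; have pi0 := @pi_gt0 R.
move: xpi2; rewrite le_eqVlt => /predU1P[->|xpi2]; first by rewrite Lam_pihalf subr0.
rewrite -[RHS]subr0 -Lam_pihalf; apply: (@is_derive0_itv (fun x => Jen x - Lam x)) => //.
- move=> y /andP[xy ypi2].
  have y0 : 0 < y by exact: le_lt_trans xy.
  have r : 0 < y < pi by lra.
  have e1 := is_derive_Jen y0; have e2 := is_derive_Lam r.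
  apply: is_derive_eq; apply/eqP; rewrite subr_eq0; apply/eqP.
  have sxy : sin x < sin y by rewrite ltr_sin// in_itv/=; apply/andP; split; lra.
  have sy0 : 0 < sin y by rewrite sin_gt0_pi.
  have k4 : k < 4 * sin y by rewrite -sx ltr_pM2l.
  rewrite /jensen ger0_norm ?mulr_ge0 ?ltW// max_r ?ltW//.
  rewrite ler0_sqrtr ?addr0; last by rewrite subr_le0 lerXn2r ?nnegrE ?mulr_ge0 ?ltW.
  by congr ln; field.
- move=> y /andP[_ ypi2]; apply: cvgB; first exact: continuous_Jen.
  by apply: continuous_Lam; lra.
Qed.

End jensen_primitive.
End lobachevsky.

(** * m(8) = 4 m(2) *)

Section m8_m2.
Context {R : realType}.

Lemma sin_pihalfB (x : R) : sin (pi / 2 - x) = cos x.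
Proof. by rewrite sinB sin_pihalf cos_pihalf mul1r mul0r subr0. Qed.

Lemma ln_2M (x : R) : 0 < x -> ln (2 * x) = ln 2 + ln x.
Proof. by move=> x0; rewrite lnM ?posrE. Qed.

Lemma sin2E (t : R) : sin (2 * t) = 2 * sin t * cos t.
Proof. by rewrite [2 * t]mulr_natl sin_mulr2n -[LHS]mulr_natl; ring. Qed.

Lemma cos2E (t : R) : cos (2 * t) = 2 * cos t ^+ 2 - 1.
Proof. by rewrite [2 * t]mulr_natl cos_mulr2n -[_ *+ 2]mulr_natl. Qed.

Lemma cosM_sin (u v : R) : 2 * (cos u * sin v) = sin (u + v) - sin (u - v).
Proof. by rewrite sinD sinB; ring. Qed.

Lemma sinM_cos (u v : R) : 2 * (sin u * cos v) = sin (u + v) + sin (u - v).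
Proof. by rewrite sinD sinB; ring. Qed.

Lemma cosM_cos (u v : R) : 2 * (cos u * cos v) = cos (u + v) + cos (u - v).
Proof. by rewrite cosD cosB; ring. Qed.

Lemma sinM_sin (u v : R) : 2 * (sin u * sin v) = cos (u - v) - cos (u + v).
Proof. by rewrite cosB cosD; ring. Qed.

(* The two conclusions are the coefficients of [dy] and of [dz] in the
   differential of the function [N] of [Jen8_Jen2]. *)
Lemma m8_m2_coefs (y z : R) : y < pi / 4 -> 0 < z -> z < y ->
  sin (2 * y) = 2 * sin (2 * z) ->
  2 * (jensen 8 (4 * sin (2 * y)) - ln (2 * sin (2 * y)))
    - 2 * ln (2 * sin (y + 2 * z)) - 2 * ln (2 * sin (pi / 2 - (y - 2 * z)))
    + 4 * ln (2 * sin (pi / 2 - (y + z))) + 4 * ln (2 * sin (y - z)) = 0 /\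
  - 8 * (jensen 2 (4 * sin (2 * z)) - ln (2 * sin (2 * z)))
    - 4 * ln (2 * sin (y + 2 * z)) + 4 * ln (2 * sin (pi / 2 - (y - 2 * z)))
    + 4 * ln (2 * sin (pi / 2 - (y + z))) - 4 * ln (2 * sin (y - z)) = 0.
Proof.
move=> y4 z0 zy yz; have pi0 := @pi_gt0 R.
have sy : 0 < sin y by rewrite sin_gt0_pi//; lra.
have cy : 0 < cos y by rewrite cos_gt0_pihalf//; lra.
have sz : 0 < sin z by rewrite sin_gt0_pi//; lra.
have cz : 0 < cos z by rewrite cos_gt0_pihalf//; lra.
have a0 : 0 < sin (y + 2 * z) by rewrite sin_gt0_pi//; lra.
have b0 : 0 < cos (y - 2 * z) by rewrite cos_gt0_pihalf//; lra.
have c0 : 0 < cos (y + z) by rewrite cos_gt0_pihalf//; lra.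
have d0 : 0 < sin (y - z) by rewrite sin_gt0_pi//; lra.
(* On the curve 64 - 16 sin^2(2y) = 64 cos^2(2z), a perfect square. Each primitive thus contributes
   the cotangent of the other variable, here cot z. *)
have jensen8 : jensen 8 (4 * sin (2 * y)) - ln (2 * sin (2 * y)) = ln (cos z) - ln (sin z).
  have -> : jensen 8 (4 * sin (2 * y)) = ln (2 * (2 * (2 * (cos z * cos z)))).
    have s1 : `|4 * sin (2 * y)| <= 8.
      by rewrite normrM ger0_norm//; have := sin_max (2 * y); lra.
    have c2z : 0 <= 8 * cos (2 * z) by rewrite mulr_ge0// cos_ge0_pihalf//; lra.
    rewrite /jensen max_l//.
    have -> : 8 ^+ 2 - (4 * sin (2 * y)) ^+ 2 = (8 * cos (2 * z)) ^+ 2.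
      by rewrite yz !exprMn cos2sin2; ring.
    by rewrite sqrtr_sqr ger0_norm// cos2E; congr ln; field.
  have -> : 2 * sin (2 * y) = 2 * (2 * (2 * (sin z * cos z))) by rewrite yz sin2E; ring.
  rewrite !(ln_2M, lnM) ?posrE ?mulr_gt0//; ring.
have jensen2 : jensen 2 (4 * sin (2 * z)) - ln (2 * sin (2 * z)) = ln (cos y) - ln (sin y).
  have -> : jensen 2 (4 * sin (2 * z)) = ln (2 * (cos y * cos y)).
    have -> : 4 * sin (2 * z) = 2 * sin (2 * y) by rewrite yz; ring.
    have s1 : `|2 * sin (2 * y)| <= 2.
      by rewrite normrM ger0_norm//; have := sin_max (2 * y); lra.
    have c2y : 0 <= 2 * cos (2 * y) by rewrite mulr_ge0// cos_ge0_pihalf//; lra.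
    rewrite /jensen max_l//.
    have -> : 2 ^+ 2 - (2 * sin (2 * y)) ^+ 2 = (2 * cos (2 * y)) ^+ 2.
      by rewrite !exprMn cos2sin2; ring.
    by rewrite sqrtr_sqr ger0_norm// cos2E; congr ln; field.
  have -> : 2 * sin (2 * z) = 2 * (sin y * cos y) by rewrite -yz sin2E; ring.
  rewrite !(ln_2M, lnM) ?posrE ?mulr_gt0//; ring.
(* Half of the dy coefficient. On the curve, 2 cos(y + z) sin(y - z) = sin 2y - sin 2z = sin 2z, and
   sin 2y + sin 4z = 4 sin(2z) cos^2 z. *)
have rel1 : ln (cos z) + 2 * ln (cos (y + z)) + 2 * ln (sin (y - z)) + 2 * ln 2 =
  ln (sin z) + ln (sin (y + 2 * z)) + ln (cos (y - 2 * z)).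
  have cd : 2 * (cos (y + z) * sin (y - z)) = sin (2 * z).
    have -> : sin (2 * z) = sin (2 * y) - sin (2 * z) by rewrite yz; ring.
    by rewrite cosM_sin; congr (sin _ - sin _); ring.
  have ab : 2 * (sin (y + 2 * z) * cos (y - 2 * z)) = sin (2 * y) + sin (2 * (2 * z)).
    by rewrite sinM_cos; congr (sin _ + sin _); ring.
  have E : cos z * (2 * (cos (y + z) * sin (y - z))) * (2 * (cos (y + z) * sin (y - z))) =
      sin z * (sin (y + 2 * z) * cos (y - 2 * z)).
    rewrite cd; apply: (@mulfI _ 2) => //.
    rewrite [2 * (sin z * _)]mulrCA ab yz !sin2E cos2E; ring.
  move/(congr1 (@ln R)): E.
  rewrite !(ln_2M, lnM) ?posrE ?mulr_gt0//; lra.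
(* A quarter of the dz coefficient. Once products are sums, replacing sin 2y by 2 sin 2z makes both
   sides polynomials in cos y and cos z. *)
have rel2 : 2 * ln (sin y) + ln (cos (y - 2 * z)) + ln (cos (y + z)) =
  2 * ln (cos y) + ln (sin (y + 2 * z)) + ln (sin (y - z)).
  have bc : 2 * (cos (y + z) * cos (y - 2 * z)) = cos (2 * y - z) + cos (2 * z + z).
    by rewrite cosM_cos; congr (cos _ + cos _); ring.
  have ad : 2 * (sin (y + 2 * z) * sin (y - z)) = cos (2 * z + z) - cos (2 * y + z).
    by rewrite sinM_sin; congr (cos _ - cos _); ring.
  have E : sin y * sin y * (cos (y + z) * cos (y - 2 * z)) =
      cos y * cos y * (sin (y + 2 * z) * sin (y - z)).
    apply: (@mulfI _ 2) => //.
    rewrite [LHS]mulrCA [RHS]mulrCA bc ad cosB !cosD yz !sin2E !cos2E.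
    have e1 := sin2cos2 y; have e2 := sin2cos2 z.
    set s := sin y in e1 *; set c := cos y in e1 *; set t := sin z in e2 *; set d := cos z in e2 *.
    rewrite -(expr2 s) e1.
    transitivity ((1 - c ^+ 2) * ((2 * c ^+ 2 - 1) * d + 4 * t ^+ 2 * d +
      ((2 * d ^+ 2 - 1) * d - 2 * t ^+ 2 * d))); first by ring.
    transitivity (c ^+ 2 * (((2 * d ^+ 2 - 1) * d - 2 * t ^+ 2 * d) -
      ((2 * c ^+ 2 - 1) * d - 4 * t ^+ 2 * d))); last by ring.
    by rewrite e2; ring.
  move/(congr1 (@ln R)): E.
  rewrite !lnM ?posrE ?mulr_gt0//; lra.
split; first by rewrite jensen8 !sin_pihalfB !ln_2M//; lra.
by rewrite jensen2 !sin_pihalfB !ln_2M//; lra.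
Qed.

End m8_m2.

(** * Integration along the curve sin 2y = 2 sin 2z *)

Section m8_m2_identity.
Context {R : realType}.

(** Solves the equation of the curve for z. The argument of [asin] stays within [-1/2, 1/2], so [Z]
    is differentiable everywhere, also at the endpoints 0 and pi/4. *)
Let Z (y : R) : R := asin (sin (2 * y) / 2) / 2.

Let sin_itv (y : R) : -1 < sin (2 * y) / 2 < 1.
Proof. by have := sin_le1 (2 * y); have := sin_geN1 (2 * y) => s1 s2; lra. Qed.

Let sinZ (y : R) : 2 * sin (2 * Z y) = sin (2 * y).
Proof.
have /andP[s1 s2] := sin_itv y.
rewrite /Z [2 * (_ / 2)]mulrC divfK// asinK; last by rewrite in_itv/= !ltW.
by rewrite mulrC divfK.
Qed.

(** Existence is enough: in the derivative of [N] this number multiplies a coefficient that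
    vanishes. *)
Let Z_derivable (y : R) : exists d, is_derive y 1 Z d.
Proof.
have h : is_derive y 1 (fun y => sin (2 * y) / 2) (cos (2 * y)).
  have d1 : is_derive y 1 (fun x => 2 * x) (2 : R).
    by apply: is_derive_eq; rewrite /GRing.scale/=; ring.
  have d2 := @is_derive_compE R sin (fun x => 2 * x) y _ _ (is_derive_sin _) d1.
  by apply: is_derive_eq; rewrite /GRing.scale/=; field.
have d3 := @is_derive_compE R asin _ y _ _ (is_derive1_asin (sin_itv y)) h.
eexists; rewrite /Z; apply: is_derive_eq; reflexivity.
Qed.

Let Z_itv (y : R) : 0 <= y <= pi / 4 -> 0 <= Z y <= y.
Proof.
move=> /andP[y0 y4]; have pi0 := @pi_gt0 R.
have /andP[s1 s2] := sin_itv y.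
have [l u] : - (pi / 2) <= 2 * Z y /\ 2 * Z y <= pi / 2.
  have -> : 2 * Z y = asin (sin (2 * y) / 2) by rewrite /Z mulrC divfK.
  split; first by rewrite asin_geNpi2// !ltW.
  by rewrite asin_lepi2// !ltW.
have sy0 : 0 <= sin (2 * y) by rewrite sin_ge0_pi//; lra.
have sZ := sinZ y.
have a : 0 <= 2 * Z y.
  rewrite leNgt; apply/negP => h.
  have : sin (2 * Z y) < sin 0 by rewrite ltr_sin// in_itv/=; apply/andP; split; lra.
  by rewrite sin0; lra.
have b : 2 * Z y <= 2 * y.
  rewrite leNgt; apply/negP => h.
  have : sin (2 * y) < sin (2 * Z y) by rewrite ltr_sin// in_itv/=; apply/andP; split; lra.
  by lra.
by apply/andP; split; lra.
Qed.

Let Z_gt (y : R) : 0 < y < pi / 4 -> 0 < Z y < y.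
Proof.
move=> /andP[y0 y4]; have pi0 := @pi_gt0 R.
have /andP[Z0 Zy] : 0 <= Z y <= y by apply: Z_itv; rewrite !ltW.
have sy0 : 0 < sin (2 * y) by rewrite sin_gt0_pi//; lra.
have sZ := sinZ y; rewrite !lt_neqAle Z0 Zy !andbT; apply/andP; split.
- by apply/eqP => E; move: sy0; rewrite -sZ -E mulr0 sin0 mulr0 ltxx.
- by apply/eqP => E; move: sZ; rewrite E; lra.
Qed.

(** [N] is constant on [0, pi/4]. At 0 it vanishes because Lam(pi/2) = 0; at pi/4 it is the
    difference of the two sides. *)
Lemma Jen8_Jen2 : Jen 8 (pi / 2) = 4 * Jen 2 (pi / 2) :> R.
Proof.
have pi0 := @pi_gt0 R.
pose N y : R := (Jen 8 (2 * y) - Lam (2 * y)) - 4 * (Jen 2 (2 * Z y) - Lam (2 * Z y))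
  - 2 * Lam (y + 2 * Z y) + 2 * Lam (pi / 2 - (y - 2 * Z y))
  - 4 * Lam (pi / 2 - (y + Z y)) + 4 * Lam (y - Z y).
have N04 : N 0 = N (pi / 4).
  apply: is_derive0_itv.
  - by rewrite divr_gt0.
  - move=> y y04; have /andP[Z0 Zy] := Z_gt y04; have /andP[y0 y4] := y04.
    have [d dZ] := Z_derivable y.
    have dy : is_derive y 1 (fun x => 2 * x) (2 : R).
      by apply: is_derive_eq; rewrite /GRing.scale/=; ring.
    have dz : is_derive y 1 (fun x => 2 * Z x) (2 * d).
      by apply: is_derive_eq; rewrite /GRing.scale/=; ring.
    have d1 : is_derive y 1 (fun x => x + 2 * Z x) (1 + 2 * d).
      by apply: is_derive_eq; rewrite /GRing.scale/=; ring.
    have d2 : is_derive y 1 (fun x => pi / 2 - (x - 2 * Z x)) (- (1 - 2 * d)).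
      by apply: is_derive_eq; rewrite /GRing.scale/=; ring.
    have d3 : is_derive y 1 (fun x => pi / 2 - (x + Z x)) (- (1 + d)).
      by apply: is_derive_eq; rewrite /GRing.scale/=; ring.
    have d4 : is_derive y 1 (fun x => x - Z x) (1 - d).
      by apply: is_derive_eq; rewrite /GRing.scale/=; ring.
    have y2 : 0 < 2 * y by lra.
    have z2 : 0 < 2 * Z y by lra.
    have r1 : 0 < 2 * y < pi by lra.
    have r2 : 0 < 2 * Z y < pi by lra.
    have r3 : 0 < y + 2 * Z y < pi by lra.
    have r4 : 0 < pi / 2 - (y - 2 * Z y) < pi by lra.
    have r5 : 0 < pi / 2 - (y + Z y) < pi by lra.
    have r6 : 0 < y - Z y < pi by lra.
    have k8 : (0 : R) < 8 by [].
    have k2 : (0 : R) < 2 by [].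
    have e1 := @is_derive_compE R (Jen 8) (fun x => 2 * x) _ _ _ (is_derive_Jen k8 y2) dy.
    have e2 := @is_derive_compE R Lam (fun x => 2 * x) _ _ _ (is_derive_Lam r1) dy.
    have e3 := @is_derive_compE R (Jen 2) (fun x => 2 * Z x) _ _ _ (is_derive_Jen k2 z2) dz.
    have e4 := @is_derive_compE R Lam (fun x => 2 * Z x) _ _ _ (is_derive_Lam r2) dz.
    have e5 := @is_derive_compE R Lam (fun x => x + 2 * Z x) _ _ _ (is_derive_Lam r3) d1.
    have e6 := @is_derive_compE R Lam (fun x => pi / 2 - (x - 2 * Z x)) _ _ _ (is_derive_Lam r4) d2.
    have e7 := @is_derive_compE R Lam (fun x => pi / 2 - (x + Z x)) _ _ _ (is_derive_Lam r5) d3.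
    have e8 := @is_derive_compE R Lam (fun x => x - Z x) _ _ _ (is_derive_Lam r6) d4.
    have [A B] := m8_m2_coefs y4 Z0 Zy (esym (sinZ y)).
    apply: is_derive_eq; rewrite /GRing.scale/=.
    (* By the chain rule the derivative is the dy coefficient plus Z'(y) times the dz
       coefficient. *)
    have := congr2 (fun u v => u + d * v) A B; rewrite /= mulr0 addr0 => <-.
    by ring.
  - move=> y y04; have /andP[Z0 Zy] := Z_itv y04; have /andP[y0 y4] := y04.
    have [d dZ] := Z_derivable y.
    have cZ : {for y, continuous Z}.
      by apply: differentiable_continuous; apply/derivable1_diffP; exact: ex_derive.
    have cy : {for y, continuous (fun x : R => 2 * x)}.
      by apply: cvgM; [exact: cvg_cst|exact: cvg_id].
    have cz : {for y, continuous (fun x : R => 2 * Z x)}.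
      by apply: cvgM; [exact: cvg_cst|exact: cZ].
    have c1 : {for y, continuous (fun x : R => x + 2 * Z x)}.
      by apply: cvgD; [exact: cvg_id|exact: cz].
    have c2 : {for y, continuous (fun x : R => pi / 2 - (x - 2 * Z x))}.
      by apply: cvgB; [exact: cvg_cst|apply: cvgB; [exact: cvg_id|exact: cz]].
    have c3 : {for y, continuous (fun x : R => pi / 2 - (x + Z x))}.
      by apply: cvgB; [exact: cvg_cst|apply: cvgD; [exact: cvg_id|exact: cZ]].
    have c4 : {for y, continuous (fun x : R => x - Z x)}.
      by apply: cvgB; [exact: cvg_id|exact: cZ].
    have cJ (k : R) (f : R -> R) : 0 < k -> {for y, continuous f} ->
        {for y, continuous (fun x => Jen k (f x))}.
      by move=> k0 cf; apply: continuous_comp => //; exact: continuous_Jen.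
    apply: cvgD; last first.
      by apply: cvgM; [exact: cvg_cst|apply: (continuous_Lam_comp _ c4); lra].
    apply: cvgB; last first.
      by apply: cvgM; [exact: cvg_cst|apply: (continuous_Lam_comp _ c3); lra].
    apply: cvgD; last first.
      by apply: cvgM; [exact: cvg_cst|apply: (continuous_Lam_comp _ c2); lra].
    apply: cvgB; last first.
      by apply: cvgM; [exact: cvg_cst|apply: (continuous_Lam_comp _ c1); lra].
    apply: cvgB.
      by apply: cvgB; [exact: cJ|apply: (continuous_Lam_comp _ cy); lra].
    apply: cvgM; first exact: cvg_cst.
    by apply: cvgB; [exact: cJ|apply: (continuous_Lam_comp _ cz); lra].
have Z00 : Z 0 = 0.
  have /andP[a b] : 0 <= Z 0 <= 0 by apply: Z_itv; lra.
  by apply/eqP; rewrite eq_le a b.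
have /andP[Z40 Z44] : 0 <= Z (pi / 4) <= pi / 4 by apply: Z_itv; lra.
have E1 : 2 * (pi / 4) = pi / 2 :> R by field.
(* At the end of the curve 4 sin(2z) = 2, exactly where [jensen 2] changes its formula. *)
have E2 : Jen 2 (2 * Z (pi / 4)) - Lam (2 * Z (pi / 4)) = Jen 2 (pi / 2).
  apply: Jen_sub_Lam => //; first by lra.
  have := sinZ (pi / 4); rewrite E1 sin_pihalf; lra.
move: N04; rewrite /N Z00 E1 E2 !(mulr0, subr0, addr0) Lam0 !Jen0 Lam_pihalf.
(* At y = pi/4 the four remaining arguments of [Lam] coincide in pairs with opposite
   coefficients. *)
have -> : pi / 2 - (pi / 4 - 2 * Z (pi / 4)) = pi / 4 + 2 * Z (pi / 4) by field.
have -> : pi / 2 - (pi / 4 + Z (pi / 4)) = pi / 4 - Z (pi / 4) by field.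
by lra.
Qed.

End m8_m2_identity.

(** * m(5) = 6 m(1) *)

Section m5_m1.
Context {R : realType}.

Section angles.
(* The parameter [p] rationalises the square roots in [jensen 1 (4 * sin w)] and
   [jensen 5 (4 * sin (2 * x - w))]; for instance
   [1 - (4 * s) ^+ 2 = ((1 - p ^+ 2) / (1 + p ^+ 2)) ^+ 2]. *)
Variables p s w x : R.
Hypothesis hs : s * (2 * (1 + p ^+ 2)) = p.
Hypothesis hw : sin w = s.
Hypothesis hx : cos w * sin x = (p + s) * cos x.
Hypothesis c0 : 0 < cos w.

Let hc : cos w ^+ 2 = 1 - s ^+ 2. Proof. by rewrite cos2sin2 hw. Qed.

(** [hx] is this relation rearranged. With q = 1 + p^2, the later lemmas give cos(x + 2w) = cos x /
    q^2 and sin(x - 3w) = p^5 cos x / q^2; all are cos x times a monomial in p and q, and cos x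
    drops out of both coefficients. *)
Lemma m5_m1_sin_xw : sin (x - w) = p * cos x.
Proof. by rewrite sinB hw [sin x * _]mulrC hx; ring. Qed.

Lemma m5_m1_cos_xw : cos w * cos (x - w) = cos x * (1 + s * p).
Proof.
rewrite cosB hw; transitivity (cos x * cos w ^+ 2 + s * (cos w * sin x)); first by ring.
by rewrite hc hx; ring.
Qed.

Let cos2w : cos (2 * w) = 1 - 2 * s ^+ 2.
Proof. by rewrite cos2E hc; ring. Qed.

Lemma m5_m1_cos_x2w : cos (x + 2 * w) * (1 + p ^+ 2) ^+ 2 = cos x.
Proof.
have -> : cos (x + 2 * w) = cos x * (1 - 4 * s ^+ 2 - 2 * p * s).
  rewrite cosD cos2w sin2E hw.
  transitivity (cos x * (1 - 2 * s ^+ 2) - 2 * s * (cos w * sin x)); first by ring.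
  by rewrite hx; ring.
transitivity (cos x * ((1 + p ^+ 2) ^+ 2 - (s * (2 * (1 + p ^+ 2))) ^+ 2 -
  (1 + p ^+ 2) * p * (s * (2 * (1 + p ^+ 2))))); first by ring.
by rewrite hs; ring.
Qed.

Lemma m5_m1_sin_x3w : sin (x - 3 * w) * (1 + p ^+ 2) ^+ 2 = p * (p ^+ 2) ^+ 2 * cos x.
Proof.
have -> : sin (x - 3 * w) = cos x * (p - 2 * s - 4 * p * s ^+ 2).
  have -> : x - 3 * w = (x - w) - 2 * w by ring.
  rewrite sinB cos2w sin2E hw m5_m1_sin_xw.
  transitivity (p * cos x * (1 - 2 * s ^+ 2) - 2 * s * (cos w * cos (x - w))); first by ring.
  by rewrite m5_m1_cos_xw; ring.
transitivity (cos x * (p * (1 + p ^+ 2) ^+ 2 - (1 + p ^+ 2) * (s * (2 * (1 + p ^+ 2))) -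
  p * (s * (2 * (1 + p ^+ 2))) ^+ 2)); first by ring.
by rewrite hs; ring.
Qed.

Let cos2x : cos w ^+ 2 = cos x ^+ 2 * (1 + p ^+ 2 + 2 * p * s).
Proof.
transitivity (cos w ^+ 2 * cos x ^+ 2 + (cos w * sin x) ^+ 2).
  by rewrite exprMn sin2cos2; ring.
by rewrite hx hc; ring.
Qed.

(** The factor 1 - p^2 locates the end of the curve: at p = 1 the angle 2x - w is pi/2. *)
Lemma m5_m1_cosE : cos w * cos (2 * x - w) = cos x ^+ 2 * (1 - p ^+ 2).
Proof.
have -> : 2 * x - w = x + (x - w) by ring.
rewrite cosD m5_m1_sin_xw mulrBr.
transitivity (cos x * (cos w * cos (x - w)) - (cos w * sin x) * (p * cos x)); first by ring.
by rewrite m5_m1_cos_xw hx; ring.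
Qed.

(** With u = p / (1 + p^2) = 2 sin w, this says (4/5) sin(2x - w) = 2 u / (1 + u^2), so that 25 - 16
    sin^2(2x - w) is a square of a rational function of p. *)
Lemma m5_m1_sinE :
  sin (2 * x - w) * ((1 + p ^+ 2) ^+ 2 + p ^+ 2) = 5 / 2 * p * (1 + p ^+ 2).
Proof.
have x0 : cos x != 0.
  apply/eqP => x0; move: cos2x; rewrite x0 expr0n mul0r => /eqP.
  by rewrite expf_eq0/= gt_eqF.
have E : cos w ^+ 2 * sin (2 * x - w) = cos x ^+ 2 * (2 * p + s * (1 + p ^+ 2)).
  have -> : 2 * x - w = x + (x - w) by ring.
  rewrite sinD m5_m1_sin_xw.
  transitivity ((cos w * sin x) * (cos w * cos (x - w)) + p * cos w ^+ 2 * cos x ^+ 2).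
    by ring.
  by rewrite m5_m1_cos_xw hx hc; ring.
have E2 : sin (2 * x - w) * (1 + p ^+ 2 + 2 * p * s) = 2 * p + s * (1 + p ^+ 2).
  have x20 : cos x ^+ 2 != 0 by rewrite expf_neq0.
  by apply: (mulfI x20); rewrite -E cos2x; ring.
transitivity (sin (2 * x - w) * (1 + p ^+ 2 + 2 * p * s) * (1 + p ^+ 2) +
  sin (2 * x - w) * p * (p - s * (2 * (1 + p ^+ 2)))); first by ring.
rewrite E2 hs.
transitivity (2 * p * (1 + p ^+ 2) + (1 + p ^+ 2) / 2 * (s * (2 * (1 + p ^+ 2)))).
  by field.
by rewrite hs; field.
Qed.

End angles.
End m5_m1.

Section m5_m1_coefs.
Context {R : realType}.

(** The angles are known only through their sines; a crude lower bound then decides their sign. *)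
Lemma sin_gt0_pos (t : R) : - pi <= t -> 0 < sin t -> 0 < t.
Proof.
move=> t1 st; rewrite ltNge; apply/negP => t0.
have : 0 <= sin (- t) by rewrite sin_ge0_pi//; lra.
by rewrite sinN; lra.
Qed.

Variables p s w x : R.
Hypothesis p0 : 0 < p.
Hypothesis p1 : p < 1.
Hypothesis hs : s * (2 * (1 + p ^+ 2)) = p.
Hypothesis hw : sin w = s.
Hypothesis hx : cos w * sin x = (p + s) * cos x.
Hypothesis w0 : 0 <= w.
Hypothesis w4 : w < pi / 4.
Hypothesis x0 : 0 <= x.
Hypothesis x2 : x < pi / 2.

Lemma m5_m1_args : [/\ 0 < w, 0 < x - w, 0 < x - 3 * w & 0 < pi / 2 - (x + 2 * w)].
Proof.
move: p0 w0 w4 x0 x2 => p0' w0' w4' x0' x2'; have pi0 := @pi_gt0 R.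
have c0 : 0 < cos w by rewrite cos_gt0_pihalf//; lra.
have cx : 0 < cos x by rewrite cos_gt0_pihalf//; lra.
have q0 : 0 < 1 + p ^+ 2 by rewrite ltr_wpDr ?sqr_ge0.
have q2 : 0 < (1 + p ^+ 2) ^+ 2 by rewrite exprn_gt0.
have s0 : 0 < s.
  by rewrite -(pmulr_lgt0 _ (x := 2 * (1 + p ^+ 2))) ?hs// mulr_gt0.
split.
- by apply: sin_gt0_pos; [lra|rewrite hw].
- by apply: sin_gt0_pos; [lra|rewrite (m5_m1_sin_xw hw hx) mulr_gt0].
- apply: sin_gt0_pos; first lra.
  rewrite -(pmulr_lgt0 _ q2) (m5_m1_sin_x3w hs hw hx)//.
  by rewrite !mulr_gt0// exprn_gt0// exprn_gt0.
- apply: sin_gt0_pos; first lra.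
  by rewrite sin_pihalfB -(pmulr_lgt0 _ q2) (m5_m1_cos_x2w hs hw hx).
Qed.

(* The coefficients of [dx] and of [dw] in the differential of the function [N]
   of [Jen5_Jen1]. *)
Lemma m5_m1_coefs :
  4 * (jensen 5 (4 * sin (2 * x - w)) - ln (2 * sin (2 * x - w)))
    - ln (2 * sin (x - w)) + ln (2 * sin (x - 3 * w))
    - ln (2 * sin (pi / 2 - x)) + ln (2 * sin (pi / 2 - (x + 2 * w))) = 0 /\
  - 2 * (jensen 5 (4 * sin (2 * x - w)) - ln (2 * sin (2 * x - w)))
    - 12 * (jensen 1 (4 * sin w) - ln (2 * sin w))
    + ln (2 * sin (x - w)) - 3 * ln (2 * sin (x - 3 * w))
    + 2 * ln (2 * sin (pi / 2 - (x + 2 * w))) = 0.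
Proof.
have [w_gt0 xw x3w x2w] := m5_m1_args.
move: p0 p1 w0 w4 x0 x2 => p0' p1' w0' w4' x0' x2'; have pi0 := @pi_gt0 R.
have c0 : 0 < cos w by rewrite cos_gt0_pihalf//; lra.
have cx : 0 < cos x by rewrite cos_gt0_pihalf//; lra.
have q0 : 0 < 1 + p ^+ 2 by rewrite ltr_wpDr ?sqr_ge0.
have q2 : 0 < (1 + p ^+ 2) ^+ 2 by rewrite exprn_gt0.
have D0 : 0 < (1 + p ^+ 2) ^+ 2 + p ^+ 2 by rewrite ltr_pwDl ?sqr_ge0.
have q_neq0 : 1 + p ^+ 2 != 0 by rewrite gt_eqF.
have p_neq0 : p != 0 by rewrite gt_eqF.
have D_neq0 : (1 + p ^+ 2) ^+ 2 + p ^+ 2 != 0 by rewrite gt_eqF.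
have sE : sin (2 * x - w) = 5 / 2 * p * (1 + p ^+ 2) / ((1 + p ^+ 2) ^+ 2 + p ^+ 2).
  by rewrite -(m5_m1_sinE hs hw hx c0) mulfK.
have sE0 : 0 < sin (2 * x - w) by rewrite sE divr_gt0// !mulr_gt0.
have wE : s = p / (2 * (1 + p ^+ 2)).
  by apply: (mulIf (x := 2 * (1 + p ^+ 2))); rewrite ?hs ?divfK// mulf_neq0.
(* From here every logarithm is reduced to ln 2, ln p, ln q and ln (cos x), up to the terms ln (2
   sin) that cancel against [jensen]; the two claims become linear identities. *)
set q := 1 + p ^+ 2 in q0 q2 D0 q_neq0 D_neq0 sE wE *.
have lxw : ln (2 * sin (x - w)) = ln 2 + ln p + ln (cos x).
  by rewrite (m5_m1_sin_xw hw hx) !lnM ?posrE ?mulr_gt0//; ring.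
have lx3w : ln (2 * sin (x - 3 * w)) = ln 2 + 5 * ln p + ln (cos x) - 2 * ln q.
  have -> : sin (x - 3 * w) = p * (p * p) * (p * p) * cos x / (q * q).
    apply: (mulIf (lt0r_neq0 q2)); rewrite (m5_m1_sin_x3w hs hw hx).
    by field.
  by rewrite ln_2M ?ln_div ?lnM ?posrE ?divr_gt0 ?mulr_gt0//; ring.
have lx : ln (2 * sin (pi / 2 - x)) = ln 2 + ln (cos x) by rewrite sin_pihalfB ln_2M.
have lx2w : ln (2 * sin (pi / 2 - (x + 2 * w))) = ln 2 + ln (cos x) - 2 * ln q.
  have -> : sin (pi / 2 - (x + 2 * w)) = cos x / (q * q).
    rewrite sin_pihalfB; apply: (mulIf (lt0r_neq0 q2)); rewrite (m5_m1_cos_x2w hs hw hx).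
    by field.
  by rewrite ln_2M ?ln_div ?lnM ?posrE ?divr_gt0 ?mulr_gt0//; ring.
have j5 : jensen 5 (4 * sin (2 * x - w)) = ln (2 * sin (2 * x - w)) + ln q - ln p.
  have s1 : `|4 * sin (2 * x - w)| <= 5.
    by rewrite normrM ger0_norm//; have := sin_max (2 * x - w); lra.
  rewrite /jensen max_l//.
  have -> : 5 ^+ 2 - (4 * sin (2 * x - w)) ^+ 2 =
      (5 * (q ^+ 2 - p ^+ 2) / (q ^+ 2 + p ^+ 2)) ^+ 2.
    by rewrite sE; field.
  rewrite sqrtr_sqr ger0_norm; last first.
    rewrite divr_ge0 ?mulr_ge0 ?(ltW D0)// subr_ge0 lerXn2r ?nnegrE ?ltW//.
    by rewrite /q; nra.
  rewrite -lnM ?posrE ?mulr_gt0// -ln_div ?posrE ?mulr_gt0//; congr ln.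
  by rewrite sE; field; rewrite p_neq0 D_neq0.
have j1 : jensen 1 (4 * sin w) = ln (2 * sin w) - ln p.
  have q2p : 2 * p <= q by rewrite /q; nra.
  have s1 : `|4 * sin w| <= 1.
    have -> : 4 * sin w = 2 * p / q by rewrite hw wE; field.
    by rewrite ger0_norm ?ler_pdivrMr ?mul1r// divr_ge0 ?mulr_ge0 ?ltW.
  rewrite /jensen max_l//.
  have -> : 1 ^+ 2 - (4 * sin w) ^+ 2 = ((1 - p ^+ 2) / q) ^+ 2.
    rewrite hw wE; transitivity ((q ^+ 2 - 4 * p ^+ 2) / q ^+ 2); first by field.
    by rewrite exprMn exprVn; congr (_ / _); rewrite /q; ring.
  rewrite sqrtr_sqr ger0_norm; last first.
    by rewrite divr_ge0 ?(ltW q0)//; nra.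
  rewrite -ln_div ?posrE ?hw ?wE ?mulr_gt0 ?invr_gt0 ?mulr_gt0//; congr ln.
  transitivity ((q + (1 - p ^+ 2)) / (2 * q)); first by field.
  have -> : q + (1 - p ^+ 2) = 2 by rewrite /q; ring.
  by field; rewrite ?q_neq0 ?p_neq0.
by rewrite lxw lx3w lx lx2w j5 j1; split; ring.
Qed.

End m5_m1_coefs.

(** * Integration along the curve parametrised by p in [0, 1] *)

Section m5_m1_identity.
Context {R : realType}.

(** [S], [W] and [X] solve [hs], [hw] and [hx] for s, w and x. Both angles are 0 at p = 0. *)
Let S (p : R) : R := p / (2 * (1 + p ^+ 2)).
Let W (p : R) : R := asin (S p).
Let X (p : R) : R := atan ((p + S p) / cos (W p)).

Let q_gt0 (p : R) : 0 < 1 + p ^+ 2.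
Proof. by rewrite ltr_wpDr ?sqr_ge0. Qed.

Let SE (p : R) : S p * (2 * (1 + p ^+ 2)) = p.
Proof. by rewrite /S divfK// mulf_neq0// gt_eqF. Qed.

Let S_le (p : R) : -1 < S p < 1.
Proof.
have q2 : 0 < 2 * (1 + p ^+ 2) by rewrite mulr_gt0.
have h1 := sqr_ge0 (p - 1); have h2 := sqr_ge0 (p + 1).
by rewrite /S ltr_pdivrMr// ltr_pdivlMr// !(mul1r, mulN1r); apply/andP; split; nra.
Qed.

Let sinW (p : R) : sin (W p) = S p.
Proof. by have /andP[s1 s2] := S_le p; rewrite /W asinK; last rewrite in_itv/= !ltW. Qed.

Let W_itv (p : R) : - (pi / 2) < W p < pi / 2.
Proof. by have /andP[s1 s2] := S_le p; rewrite /W asin_gtNpi2 ?asin_ltpi2 ?s1 ?s2 ?ltW. Qed.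

Let cosW (p : R) : 0 < cos (W p).
Proof. by rewrite cos_gt0_pihalf. Qed.

Let X_itv (p : R) : - (pi / 2) < X p < pi / 2.
Proof. by rewrite /X atan_gtNpi2 atan_ltpi2. Qed.

Let sinX (p : R) : cos (W p) * sin (X p) = (p + S p) * cos (X p).
Proof.
have cX : 0 < cos (X p) by rewrite cos_gt0_pihalf.
have : tan (X p) = (p + S p) / cos (W p) by rewrite /X atanK.
move/(congr1 (fun t => t * cos (X p) * cos (W p))).
rewrite /tan divfK ?(lt0r_neq0 cX)// mulrC => ->.
by rewrite mulrAC divfK// (lt0r_neq0 (cosW p)).
Qed.

Let S_derivable (p : R) : exists d, is_derive p 1 S d.
Proof.
have d1 : is_derive p 1 (fun p : R => 2 * (1 + p ^+ 2)) (4 * p).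
  by apply: is_derive_eq; rewrite /GRing.scale/=; ring.
have q_neq0 : 2 * (1 + p ^+ 2) != 0 by rewrite mulf_neq0// gt_eqF.
have d2 := @is_deriveV R (fun p : R => 2 * (1 + p ^+ 2)) p _ _ q_neq0 d1.
by eexists; rewrite /S; apply: is_derive_eq; reflexivity.
Qed.

Let W_derivable (p : R) : exists d, is_derive p 1 W d.
Proof.
have [d dS] := S_derivable p; eexists.
exact: (@is_derive_compE R asin S p _ _ (is_derive1_asin (S_le p)) dS).
Qed.

Let X_derivable (p : R) : exists d, is_derive p 1 X d.
Proof.
have [d dS] := S_derivable p; have [e dW] := W_derivable p.
have d1 := @is_derive_compE R cos W p _ _ (is_derive_cos _) dW.
have c_neq0 : cos (W p) != 0 by rewrite gt_eqF.
have d2 := @is_deriveV R (fun p : R => cos (W p)) p _ _ c_neq0 d1.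
have d3 : exists d3, is_derive p 1 (fun p => (p + S p) / cos (W p)) d3.
  by eexists; apply: is_derive_eq; reflexivity.
have [f d4] := d3; eexists.
exact: (@is_derive_compE R atan _ p _ _ (is_derive1_atan _) d4).
Qed.

Let W_ge0 (p : R) : 0 <= p -> 0 <= W p.
Proof.
move=> p0; have pi0 := @pi_gt0 R; have /andP[w1 w2] := W_itv p.
rewrite leNgt; apply/negP => h.
have : sin (W p) < sin 0 by rewrite ltr_sin// in_itv/=; apply/andP; split; lra.
by rewrite sinW sin0 ltNge divr_ge0// mulr_ge0// ltW.
Qed.

(** (p - 1)^2 >= 0 gives S p <= 1/4, while sin^2(pi/4) = 1/2. *)
Let W_lt (p : R) : W p < pi / 4.
Proof.
have pi0 := @pi_gt0 R; have /andP[w1 w2] := W_itv p.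
rewrite ltNge; apply/negP; rewrite le_eqVlt => h.
have : sin (pi / 4) <= S p.
  rewrite -sinW; move: h => /predU1P[->//|h]; apply/ltW.
  by rewrite ltr_sin// in_itv/=; apply/andP; split; lra.
have s0 : 0 < sin (pi / 4 : R) by rewrite sin_gt0_pi//; lra.
have s2 : sin (pi / 4 : R) ^+ 2 = 1 / 2.
  have := cos2E (pi / 4 : R); have -> : 2 * (pi / 4) = pi / 2 :> R by field.
  by rewrite cos_pihalf sin2cos2; lra.
have s1 : S p <= 1 / 4.
  rewrite /S ler_pdivrMr ?mulr_gt0//; have hp := sqr_ge0 (p - 1); nra.
by move: (sin _) s0 s2 (S p) s1 => u u0 u2 s s1 us; nra.
Qed.

Let X_ge0 (p : R) : 0 <= p -> 0 <= X p.
Proof.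
move=> p0; rewrite -(@atan0 R) /X; apply: le_atan.
by rewrite divr_ge0 ?(ltW (cosW p))// addr_ge0// /S divr_ge0// mulr_ge0// ltW.
Qed.

(** [N] vanishes at p = 0, where its last two nonzero terms are Lam(pi/2) with opposite signs. At p
    = 1 it is twice the difference of the two sides, since then 2X - W = pi/2 and 4 sin W = 1. *)
Lemma Jen5_Jen1 : Jen 5 (pi / 2) = 6 * Jen 1 (pi / 2) :> R.
Proof.
have pi0 := @pi_gt0 R.
have k5 : (0 : R) < 5 by []. have k1 : (0 : R) < 1 by [].
pose N p : R := 2 * (Jen 5 (2 * X p - W p) - Lam (2 * X p - W p))
  - 12 * (Jen 1 (W p) - Lam (W p))
  - Lam (X p - W p) + Lam (X p - 3 * W p)
  + Lam (pi / 2 - X p) - Lam (pi / 2 - (X p + 2 * W p)).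
have N01 : N 0 = N 1.
  apply: is_derive0_itv.
  - exact: ltr01.
  - move=> p /andP[p0 p1]; have /andP[_ x2] := X_itv p.
    have w0 := W_ge0 (ltW p0); have w4 := W_lt p; have x0 := X_ge0 (ltW p0).
    have [w_gt0 xw x3w x2w] := m5_m1_args p0 (SE p) (sinW p) (sinX p) w0 w4 x0 x2.
    have [A B] := m5_m1_coefs p0 p1 (SE p) (sinW p) (sinX p) w0 w4 x0 x2.
    have [d dW] := W_derivable p; have [e dX] := X_derivable p.
    have d1 : is_derive p 1 (fun p => 2 * X p - W p) (2 * e - d).
      by apply: is_derive_eq; rewrite /GRing.scale/=; ring.
    have d2 : is_derive p 1 (fun p => X p - W p) (e - d).
      by apply: is_derive_eq; rewrite /GRing.scale/=; ring.
    have d3 : is_derive p 1 (fun p => X p - 3 * W p) (e - 3 * d).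
      by apply: is_derive_eq; rewrite /GRing.scale/=; ring.
    have d4 : is_derive p 1 (fun p => pi / 2 - X p) (- e).
      by apply: is_derive_eq; rewrite /GRing.scale/=; ring.
    have d5 : is_derive p 1 (fun p => pi / 2 - (X p + 2 * W p)) (- (e + 2 * d)).
      by apply: is_derive_eq; rewrite /GRing.scale/=; ring.
    have E0 : 0 < 2 * X p - W p by lra.
    have r1 : 0 < 2 * X p - W p < pi by lra.
    have r2 : 0 < W p < pi by lra.
    have r3 : 0 < X p - W p < pi by lra.
    have r4 : 0 < X p - 3 * W p < pi by lra.
    have r5 : 0 < pi / 2 - X p < pi by lra.
    have r6 : 0 < pi / 2 - (X p + 2 * W p) < pi by lra.
    have e1 := @is_derive_compE R (Jen 5) (fun p => 2 * X p - W p) _ _ _ (is_derive_Jen k5 E0) d1.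
    have e2 := @is_derive_compE R Lam (fun p => 2 * X p - W p) _ _ _ (is_derive_Lam r1) d1.
    have e3 := @is_derive_compE R (Jen 1) W _ _ _ (is_derive_Jen k1 w_gt0) dW.
    have e4 := @is_derive_compE R Lam W _ _ _ (is_derive_Lam r2) dW.
    have e5 := @is_derive_compE R Lam (fun p => X p - W p) _ _ _ (is_derive_Lam r3) d2.
    have e6 := @is_derive_compE R Lam (fun p => X p - 3 * W p) _ _ _ (is_derive_Lam r4) d3.
    have e7 := @is_derive_compE R Lam (fun p => pi / 2 - X p) _ _ _ (is_derive_Lam r5) d4.
    have e8 := @is_derive_compE R Lam (fun p => pi / 2 - (X p + 2 * W p)) _ _ _
      (is_derive_Lam r6) d5.
    apply: is_derive_eq; rewrite /GRing.scale/=.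
    have := congr2 (fun u v => e * u + d * v) A B; rewrite /= !mulr0 addr0 => <-.
    by ring.
  - move=> p /andP[p0 p1]; have /andP[_ x2] := X_itv p.
    have w0 := W_ge0 p0; have w4 := W_lt p; have x0 := X_ge0 p0.
    have [d dW] := W_derivable p; have [e dX] := X_derivable p.
    have cW : {for p, continuous W}.
      by apply: differentiable_continuous; apply/derivable1_diffP; exact: ex_derive.
    have cX : {for p, continuous X}.
      by apply: differentiable_continuous; apply/derivable1_diffP; exact: ex_derive.
    have cM (c : R) (f : R -> R) : {for p, continuous f} -> {for p, continuous (fun p => c * f p)}.
      by move=> cf; apply: cvgM; [exact: cvg_cst|exact: cf].
    have c1 : {for p, continuous (fun p => 2 * X p - W p)}.
      by apply: cvgB; [exact: cM|exact: cW].
    have c2 : {for p, continuous (fun p => X p - W p)}.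
      by apply: cvgB; [exact: cX|exact: cW].
    have c3 : {for p, continuous (fun p => X p - 3 * W p)}.
      by apply: cvgB; [exact: cX|exact: cM].
    have c4 : {for p, continuous (fun p => pi / 2 - X p)}.
      by apply: cvgB; [exact: cvg_cst|exact: cX].
    have c5 : {for p, continuous (fun p => pi / 2 - (X p + 2 * W p))}.
      by apply: cvgB; [exact: cvg_cst|apply: cvgD; [exact: cX|exact: cM]].
    have cJ (k : R) (f : R -> R) : 0 < k -> {for p, continuous f} ->
        {for p, continuous (fun x => Jen k (f x))}.
      by move=> k0 cf; apply: continuous_comp => //; exact: continuous_Jen.
    apply: cvgB; last by apply: (continuous_Lam_comp _ c5); lra.
    apply: cvgD; last by apply: (continuous_Lam_comp _ c4); lra.
    apply: cvgD; last by apply: (continuous_Lam_comp _ c3); lra.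
    apply: cvgB; last by apply: (continuous_Lam_comp _ c2); lra.
    apply: cvgB.
      apply: cvgM; first exact: cvg_cst.
      by apply: cvgB; [exact: cJ|apply: (continuous_Lam_comp _ c1); lra].
    apply: cvgM; first exact: cvg_cst.
    by apply: cvgB; [exact: cJ|apply: (continuous_Lam_comp _ cW); lra].
have W0 : W 0 = 0.
  rewrite /W /S mul0r -[X in asin X](@sin0 R) sinK// in_itv/=.
  by apply/andP; split; lra.
have X0 : X 0 = 0 by rewrite /X W0 /S mul0r addr0 mul0r atan0.
have w0 := W_ge0 (ler01 : 0 <= 1 :> R); have w4 := W_lt 1.
have x0 := X_ge0 (ler01 : 0 <= 1 :> R); have /andP[_ x2] := X_itv 1.
have E : 2 * X 1 - W 1 = pi / 2.
  have xw : 0 < X 1 - W 1.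
    apply: sin_gt0_pos; first lra.
    by rewrite (m5_m1_sin_xw (sinW 1) (sinX 1)) mul1r cos_gt0_pihalf.
  apply: (@cos_inj R); rewrite ?in_itv/=; try by apply/andP; split; lra.
  apply: (mulfI (lt0r_neq0 (cosW 1))); rewrite (m5_m1_cosE (sinW 1) (sinX 1)).
  by rewrite cos_pihalf expr1n subrr !mulr0.
have S1 : S 1 = 1 / 4 by have := SE 1; rewrite expr1n; lra.
have E2 : Jen 1 (W 1) - Lam (W 1) = Jen 1 (pi / 2).
  by apply: Jen_sub_Lam => //; [lra|rewrite sinW S1; lra].
move: N01; rewrite /N W0 X0 E E2 !(mulr0, subr0, addr0) Lam0 !Jen0 Lam_pihalf.
(* Both rewritings follow from 2 X - W = pi/2 at p = 1 and make the four remaining [Lam] terms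
   cancel. *)
have -> : pi / 2 - X 1 = X 1 - W 1 by lra.
have -> : pi / 2 - (X 1 + 2 * W 1) = X 1 - 3 * W 1 by lra.
by lra.
Qed.

End m5_m1_identity.

Theorem theorem1 (R : realType) :
  (mahler_m (8 : R[i])%R = 4%:E * mahler_m (2 : R[i])%R)%E /\
  (mahler_m (5 : R[i])%R = 6%:E * mahler_m (1 : R[i])%R)%E.
Proof.
have natC (n : nat) : (n%:R : R[i]) = (n%:R%:C)%C by rewrite rmorph_nat.
split.
- rewrite (natC 8) (natC 2) !mahler_m_Jen// -EFinM Jen8_Jen2; congr EFin; ring.
- rewrite (natC 5) -[1 : R[i]]/(1%:R) (natC 1) !mahler_m_Jen// -EFinM Jen5_Jen1.
  congr EFin; ring.
Qed.
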